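(* Let $G$ be a Cayley graph of a finitely generated group $\Gamma$ and let $H_1\subseteq H_2\subseteq\Gamma$ be subgroups of $\Gamma$. If $H_1$ is $s$-normal in $H_2$ then, for each $p\in[0,1]$, $G_p$ contains a unique $H_1$-infinite cluster almost surely if and only if it contains a unique $H_2$-infinite cluster almost surely. In particular, $p_u(H_1;G)=p_u(H_2;G)$, and if $H\subseteq\Gamma$ is an $s$-normal subgroup of $\Gamma$ then $p_u(H;G)=p_u(G)$.
   Context: A subgroup $H$ of a group $\Gamma$ is $s$-normal in $\Gamma$ if $|sH\cap Hs|=\infty$ for every $s\in\Gamma$. Cayley graphs are taken with respect to finite generating sets. $G_p$ denotes Bernoulli bond percolation on $G$: each edge is independently retained (open) with probability $p$ and deleted otherwise; connected components of $G_p$ are called clusters. For a set $A$ of vertices, a cluster $K$ is called $A$-infinite if $|K\cap A|=\infty$. The relative uniqueness threshold is $p_u(A;G)=\inf\{p\in[0,1]:\text{there exists a unique }A\text{-infinite cluster in }G_p\text{ a.s.}\}$, and $p_u(G)=\inf\{p\in[0,1]:G_p\text{ has exactly one infinite cluster a.s.}\}$. *)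

(* Defs.v *)
From HB Require Import structures.
From Stdlib Require Import Relation_Operators.
From mathcomp Require Import all_boot all_order all_algebra.
From mathcomp Require Import all_classical all_reals all_analysis.
From mathcomp Require Import measurable_realfun ring lra.

Set Implicit Arguments.
Unset Strict Implicit.
Unset Printing Implicit Defensive.

Import Order.TTheory GRing.Theory Num.Theory.
Import numFieldNormedType.Exports.

Local Open Scope classical_set_scope.
Local Open Scope ring_scope.

Section Groups.
Variable gT : groupType.
Implicit Types H K S : set gT.

Definition subgroup H : Prop := group_closed [in H].

Definition generates S : Prop := smallest subgroup S = setT.

Definition s_normal H K : Prop :=
  forall s, K s ->
    infinite_set ([set (s * h)%g | h in H] `&` [set (h * s)%g | h in H]).

End Groups.

Section Percolation.
Variables (gT : groupType) (S : set gT).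

(* The Cayley graph is taken as a simple undirected graph: edges are unordered
   pairs, a generator and its inverse give the same edge, and a trivial
   generator gives none. *)
Definition cayley_edges : set (set gT) :=
  [set e | exists g s, [/\ S s, s != 1%g & e = [set g; (g * s)%g]]].

Definition open_events : set (set (cayley_edges -> bool)) :=
  [set [set w : cayley_edges -> bool | w e] | e in [set: cayley_edges]].

(* [w e = true] means that the edge [e] is open in [w]. *)
Definition config : Type := g_sigma_algebraType open_events.
HB.instance Definition _ := Measurable.on config.
HB.instance Definition _ := Pointed.on config.

Definition open_adj (w : config) (x y : gT) : Prop :=
  exists2 e : cayley_edges, w e & val e = [set x; y].

Definition cluster (w : config) (x : gT) : set gT :=
  [set y | clos_refl_trans gT (open_adj w) x y].

Definition is_cluster (w : config) (K : set gT) : Prop :=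
  exists x, K = cluster w x.

Definition rel_infinite (A K : set gT) : Prop := infinite_set (K `&` A).

Section Measure.
Variable R : realType.

Definition is_bernoulli_percolation (p : R) (P : probability config R) : Prop :=
  forall (F : seq cayley_edges) (c : cayley_edges -> bool), uniq F ->
    P [set w | forall e, e \in F -> w e = c e] =
    (\prod_(e <- F) bernoulli_pmf p (c e))%:E.

(* For [0 <= p <= 1] there is exactly one such measure: see
   [bernoulli_percolationP] and [is_bernoulli_percolation_unique] below. *)
Definition bernoulli_percolation (p : R) : probability config R :=
  xget (\d_point : pprobability config R) (is_bernoulli_percolation p).

Definition unique_rel_infinite_as (p : R) (A : set gT) : Prop :=
  {ae bernoulli_percolation p,
    forall w, exists! K, is_cluster w K /\ rel_infinite A K}.

Definition unique_infinite_as (p : R) : Prop :=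
  {ae bernoulli_percolation p,
    forall w, exists! K, is_cluster w K /\ infinite_set K}.

(* Infima are taken in the extended reals, so that the infimum of the empty set
   is [+oo]. *)
Definition p_u_rel (A : set gT) : \bar R :=
  ereal_inf [set p%:E | p in [set p | 0 <= p <= 1 /\ unique_rel_infinite_as p A]].

Definition p_u : \bar R :=
  ereal_inf [set p%:E | p in [set p | 0 <= p <= 1 /\ unique_infinite_as p]].

End Measure.
End Percolation.

Section Existence.
Variables (R : realType) (p : R).
Hypothesis p01 : 0 <= p <= 1.

(* Independent Bernoulli(p) bits of a uniform point: the current interval is cut
   in proportion p : 1 - p, and the bit tells in which part the point lies. *)
Definition cut (lr : R * R) : R := lr.1 + p * (lr.2 - lr.1).

Fixpoint bit_itv (n : nat) (x : R) : R * R :=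
  if n is m.+1 then
    let lr := bit_itv m x in
    if x < cut lr then (lr.1, cut lr) else (cut lr, lr.2)
  else (0, 1).

Definition bit (n : nat) (x : R) : bool := x < cut (bit_itv n x).

Let U : probability _ R := uniform_prob (@ltr01 R).

Lemma measurable_bit_itv n :
  measurable_fun setT (fun x => (bit_itv n x).1) /\
  measurable_fun setT (fun x => (bit_itv n x).2).
Proof.
elim: n => [|n [m1 m2]]; first by split; exact: measurable_cst.
have mc : measurable_fun setT (fun x => cut (bit_itv n x)).
  apply: measurable_funD => //; apply: measurable_funM => //.
  exact: measurable_funB.
have mb : measurable_fun setT (fun x : R => x < cut (bit_itv n x)).
  exact: measurable_fun_ltr.
split.
- rewrite (_ : (fun _ : R => _) = fun x : R => if x < cut (bit_itv n x)
      then (bit_itv n x).1 else cut (bit_itv n x)).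
    exact: measurable_fun_ifT.
  by apply/funext => x /=; case: ifP.
- rewrite (_ : (fun _ : R => _) = fun x : R => if x < cut (bit_itv n x)
      then cut (bit_itv n x) else (bit_itv n x).2).
    exact: measurable_fun_ifT.
  by apply/funext => x /=; case: ifP.
Qed.

Lemma measurable_bit n : measurable_fun setT (bit n).
Proof.
have [m1 m2] := measurable_bit_itv n.
apply: measurable_fun_ltr => //.
apply: measurable_funD => //; apply: measurable_funM => //.
exact: measurable_funB.
Qed.

Lemma uniform_itvco (l r : R) : 0 <= l -> l <= r -> r <= 1 ->
  U `[l, r[%classic = (r - l)%:E.
Proof.
move=> l0 lr r1; rewrite /U /= /uniform_prob integral_uniform_pdf setIidl; last first.
  by move=> x /=; rewrite !in_itv/= => /andP[lx xr]; apply/andP; split; lra.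
rewrite (eq_integral (fun=> 1%:E)); last first.
  move=> x; rewrite inE/= in_itv/= /uniform_pdf => /andP[lx xr].
  by rewrite subr0 invr1 ifT//; apply/andP; split; lra.
rewrite integral_cst//= lebesgue_measure_itv/= lte_fin.
case: ltP => h; first by rewrite -EFinD mul1e.
by rewrite mule0; congr EFin; lra.
Qed.

Definition agree (d : option bool) (b : bool) : bool :=
  if d is Some c then b == c else true.

Definition weight (d : option bool) : R :=
  if d is Some c then bernoulli_pmf p c else 1.

Lemma measurable_agree (d : nat -> option bool) n N :
  measurable [set x : R | forall i, (i < N)%N -> agree (d (n + i)%N) (bit (n + i) x)].
Proof.
rewrite (_ : [set _ | _] = \bigcap_(i in [set i | (i < N)%N])
   [set x : R | agree (d (n + i)%N) (bit (n + i) x)]); last by [].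
apply: bigcap_measurableType => i _.
rewrite /agree; case: (d (n + i)%N) => [c|]; last first.
  by rewrite (_ : [set _ | _] = setT) //; apply/seteqP; split.
rewrite (_ : [set _ | _] = setT `&` bit (n + i) @^-1` [set c]).
  exact: measurable_bit.
by rewrite setTI; apply/seteqP; split => x /= /eqP.
Qed.

Lemma uniform_agree (d : nat -> option bool) N : forall n (l r : R),
  0 <= l -> l <= r -> r <= 1 ->
  (forall x, l <= x < r -> bit_itv n x = (l, r)) ->
  U (`[l, r[%classic `&` [set x : R | forall i, (i < N)%N -> agree (d (n + i)%N) (bit (n + i) x)])
  = ((r - l) * \prod_(i < N) weight (d (n + i)%N))%:E.
Proof.
elim: N => [|N IHN] n l r l0 lr r1 itvE.
  rewrite big_ord0 mulr1 -uniform_itvco //; congr (U _).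
  by apply/seteqP; split => [x []//|x ?]; split.
pose m := cut (l, r).
have /andP[p0 p1] := p01.
have lm : l <= m by rewrite /m /cut/=; nra.
have mr : m <= r by rewrite /m /cut/=; nra.
pose D := [set x : R | forall i, (i < N)%N -> agree (d (n.+1 + i)%N) (bit (n.+1 + i) x)].
have mD : measurable D by exact: measurable_agree.
have IHl : U (`[l, m[%classic `&` D) = ((m - l) * \prod_(i < N) weight (d (n.+1 + i)%N))%:E.
  apply: IHN => //; first by lra.
  move=> x /andP[lx xm]; rewrite /= itvE; last by apply/andP; split; lra.
  by rewrite -/m xm.
have IHr : U (`[m, r[%classic `&` D) = ((r - m) * \prod_(i < N) weight (d (n.+1 + i)%N))%:E.
  apply: IHN => //; first by lra.
  move=> x /andP[mx xr]; rewrite /= itvE; last by apply/andP; split; lra.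
  by rewrite -/m ltNge mx.
have bitE x : l <= x < r -> bit n x = (x < m) by move=> /itvE; rewrite /bit => ->.
have splitE x : (forall i, (i < N.+1)%N -> agree (d (n + i)%N) (bit (n + i) x)) <->
    agree (d n) (bit n x) /\ D x.
  split=> [h|[h0 hD] [|i] iN].
  - split; first by have := h 0%N isT; rewrite addn0.
    by move=> i iN; rewrite addSnnS; apply: h.
  - by rewrite addn0.
  - by rewrite -addSnnS; apply: hD.
have -> : \prod_(i < N.+1) weight (d (n + i)%N) =
    weight (d n) * \prod_(i < N) weight (d (n.+1 + i)%N).
  rewrite big_ord_recl addn0; congr (_ * _); apply: eq_bigr => i _.
  by rewrite lift0 addSnnS.
have lrm : m - l = (r - l) * p by rewrite /m /cut/=; lra.
have rmr : r - m = (r - l) * (1 - p) by rewrite /m /cut/=; lra.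
have pl x : (`[l, m[%classic x) -> (`[l, r[%classic x) /\ x < m.
  by rewrite /= !in_itv/= => /andP[lx xm]; split=> //; apply/andP; split; lra.
have pr x : (`[m, r[%classic x) -> (`[l, r[%classic x) /\ (x < m) = false.
  rewrite /= !in_itv/= => /andP[mx xr]; split; first by apply/andP; split; lra.
  by rewrite ltNge mx.
have ex_l x : (`[l, r[%classic x) -> x < m -> `[l, m[%classic x.
  by rewrite /= !in_itv/= => /andP[-> _] ->.
have ex_r x : (`[l, r[%classic x) -> (x < m) = false -> `[m, r[%classic x.
  by rewrite /= !in_itv/= => /andP[_ ->] /negbT; rewrite -leNgt => ->.
have dE : d n = Some true \/ d n = Some false \/ d n = None.
  by case: (d n) => [[]|]; [left|right; left|right; right].
case: dE => [dn|[dn|dn]]; rewrite dn /=.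
- rewrite mulrA -lrm -IHl; congr (U _); apply/seteqP; split=> x [] => [xlr /splitE|/pl[xlr xm] Dx].
    rewrite dn /= bitE//.
    by move=> [/eqP xm Dx]; split=> //; exact: ex_l.
  split=> //; apply/splitE; split=> //; rewrite dn /= bitE ?xm//.
- rewrite mulrA -rmr -IHr; congr (U _); apply/seteqP; split=> x [] => [xlr /splitE|/pr[xlr xm] Dx].
    rewrite dn /= bitE//.
    by move=> [/eqP xm Dx]; split=> //; exact: ex_r.
  split=> //; apply/splitE; split=> //; rewrite dn /= bitE ?xm//.
- rewrite mul1r (_ : r - l = (m - l) + (r - m)); last by lra.
  rewrite mulrDl EFinD -IHl -IHr -measureU.
  + congr (U _); apply/seteqP; split=> x.
      move=> [xlr /splitE[_ Dx]]; case: (boolP (x < m)) => [xm|/negbTE xm].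
        by left; split=> //; exact: ex_l.
      by right; split=> //; exact: ex_r.
    move=> [[/pl[xlr _] Dx]|[/pr[xlr _] Dx]]; split=> //; apply/splitE;
      by rewrite dn.
  + exact: measurableI.
  + exact: measurableI.
  + apply/seteqP; split=> x //= -[[/pl[_ xm] _] [/pr[_]]].
    by rewrite xm.
Qed.

End Existence.

Section Realization.
Variables (gT : groupType) (S : set gT) (R : realType) (p : R).
Hypothesis p01 : 0 <= p <= 1.
Variable idx : cayley_edges S -> nat.
Hypothesis idx_inj : injective idx.

Let U : probability (measurableTypeR R) R := uniform_prob (@ltr01 R).

Let X (x : measurableTypeR R) : config S := fun e => bit p (idx e) x.

Lemma measurable_realization : measurable_fun setT X.
Proof.
apply: (@measurability _ _ _ (config S) setT X (@open_events gT S)); first by [].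
move=> _ [_ [e _ <-] <-].
rewrite (_ : X @^-1` _ = bit p (idx e) @^-1` [set true]).
  exact: measurable_bit.
by apply/seteqP; split.
Qed.

HB.instance Definition _ :=
  isMeasurableFun.Build _ _ _ _ X measurable_realization.

Let pattern (c : cayley_edges S -> bool) (F : seq (cayley_edges S)) (i : nat) :
    option bool :=
  foldr (fun e d => if idx e == i then Some (c e) else d) None F.

Let pattern_None c F i : (forall e, e \in F -> idx e != i) -> pattern c F i = None.
Proof.
elim: F => //= e F IHF h; rewrite (negbTE (h e _)) ?mem_head//.
by apply: IHF => e' e'F; apply: h; rewrite inE e'F orbT.
Qed.

Let pattern_agree c F N x : uniq F -> (forall e, e \in F -> (idx e < N)%N) ->
  (forall i, (i < N)%N -> agree (pattern c F i) (bit p i x)) <->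
  (forall e, e \in F -> bit p (idx e) x = c e).
Proof.
elim: F => [|e F IHF] //= /andP[eF uF] FN.
have FN' e' : e' \in F -> (idx e' < N)%N.
  by move=> e'F; apply: FN; rewrite inE e'F orbT.
have {IHF} IHF := IHF uF FN'.
have eN : (idx e < N)%N by apply: FN; exact: mem_head.
have pe : pattern c F (idx e) = None.
  apply: pattern_None => e' e'F; apply: contraNneq eF => /idx_inj <- //.
split=> [h e'|h i iN].
  rewrite inE => /orP[/eqP->|e'F]; first by have := h _ eN; rewrite eqxx => /eqP.
  apply: IHF.1 e'F => i iN; have := h i iN; case: eqP => // <- _.
  by rewrite pe.
case: eqP => [<-|_]; first by apply/eqP/h/mem_head.
by apply: IHF.2 iN => e' e'F; apply: h; rewrite inE e'F orbT.
Qed.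

Let pattern_weight c F N : uniq F -> (forall e, e \in F -> (idx e < N)%N) ->
  \prod_(i < N) weight p (pattern c F i) = \prod_(e <- F) bernoulli_pmf p (c e).
Proof.
elim: F => [|e F IHF] /=; first by rewrite big_nil big1.
move=> /andP[eF uF] FN.
have FN' e' : e' \in F -> (idx e' < N)%N.
  by move=> e'F; apply: FN; rewrite inE e'F orbT.
have eN : (idx e < N)%N by apply: FN; exact: mem_head.
have pe : pattern c F (idx e) = None.
  apply: pattern_None => e' e'F; apply: contraNneq eF => /idx_inj <- //.
rewrite big_cons -IHF // (bigD1 (Ordinal eN)) //= eqxx /=; congr (_ * _).
rewrite [RHS](bigD1 (Ordinal eN)) //= pe /= mul1r.
apply: eq_bigr => i /eqP ie; case: eqP => // eie.
by case: ie; apply/val_inj.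
Qed.

Lemma realization_bernoulli :
  is_bernoulli_percolation p (distribution U X : probability (config S) R).
Proof.
move=> F c uF; pose N := (\max_(e <- F) idx e).+1.
have FN e : e \in F -> (idx e < N)%N.
  by move=> eF; rewrite ltnS; exact: leq_bigmax_seq.
rewrite /= /distribution /pushforward.
pose A := [set x : R | forall i, (i < N)%N ->
  agree (pattern c F (0 + i)%N) (bit p (0 + i) x)].
have mA : @measurable _ (measurableTypeR R) A by exact: measurable_agree.
pose I : set (measurableTypeR R) := `[(0 : R), 1[%classic.
have mI : @measurable _ (measurableTypeR R) I by exact: measurable_itv.
have UI : U (I `&` A) = (\prod_(e <- F) bernoulli_pmf p (c e))%:E.
  rewrite uniform_agree // subr0 mul1r; congr EFin.
  exact: pattern_weight.
rewrite -UI (_ : _ @^-1` _ = (I `&` A) `|` (~` I `&` A)).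
  apply: measureU0.
  - exact: measurableI.
  - by apply: measurableI => //; exact: measurableC.
  - apply: (@subset_measure0 _ _ _ U _ (~` I)) => //.
    + by apply: measurableI => //; exact: measurableC.
    + exact: measurableC.
    + have UIC : U (~` I) = 0%E.
        by rewrite probability_setC // uniform_itvco // subr0 subee.
      exact: UIC.
rewrite -setIUl setUv setTI; apply/seteqP; split=> x; rewrite /preimage /= /X.
  by move=> /(pattern_agree c x uF FN).
by move=> /(pattern_agree c x uF FN).
Qed.

End Realization.

Section Countability.
Variables (gT : groupType) (S : set gT).
Hypotheses (finS : finite_set S) (genS : generates S).

Lemma countable_generated : countable [set: gT].
Proof.
have [s Ss] := (finite_seqP _).1 finS.
pose lett (ib : nat * bool) : gT :=
  let g := nth 1%g s ib.1 in if ib.2 then g else (g^-1)%g.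
pose f (l : seq (nat * bool)) : gT := foldr (fun ib g => lett ib * g)%g 1%g l.
have f_cat l1 l2 : f (l1 ++ l2) = (f l1 * f l2)%g.
  by elim: l1 => [|a l1 IH] /=; rewrite ?mul1g// IH mulgA.
have fV l : exists l', f l' = ((f l)^-1)%g.
  elim: l => [|[i b] l [l' IH]]; first by exists [::]; rewrite /= invg1.
  exists (l' ++ [:: (i, ~~ b)]).
  rewrite f_cat IH /= mulg1 invgM; congr (_ * _)%g.
  by rewrite /lett /=; case: b => //=; rewrite invgK.
suff -> : [set: gT] = range f.
  apply: (@sub_countable _ _ _ [set: seq (nat * bool)]); first exact: card_image_le.
  exact: countableP.
apply/esym; rewrite -subTset -genS; apply: smallest_sub.
  split; first by rewrite in_setE; exists [::].
  move=> x y; rewrite !in_setE => -[l _ <-] [l' _ <-].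
  have [l'' E] := fV l'; exists (l ++ l'') => //.
  by rewrite f_cat E.
move=> g; rewrite Ss /= => gs; exists [:: (index g s, true)] => //=.
by rewrite mulg1 /lett /= nth_index.
Qed.

Lemma countable_cayley_edges : exists idx : cayley_edges S -> nat, injective idx.
Proof.
have cE : countable (cayley_edges S).
  apply: (@sub_countable _ _ _ [set (xy.1 |` [set xy.2]) | xy in [set: gT] `*` [set: gT]]).
    apply: subset_card_le => e [g [s [_ _ ->]]].
    by exists (g, (g * s)%g).
  apply: (@sub_countable _ _ _ ([set: gT] `*` [set: gT])); first exact: card_image_le.
  by apply: countableX; exact: countable_generated.
have [f finj] := countable_injP _ cE.
exists (fun e => f (val e)) => e e' E; apply/val_inj/finj => //; exact: valP.
Qed.

End Countability.

Lemma bernoulli_percolationP (gT : groupType) (S : set gT) (R : realType) (p : R) :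
  finite_set S -> generates S -> 0 <= p <= 1 ->
  is_bernoulli_percolation p (bernoulli_percolation S p).
Proof.
move=> finS genS p01; rewrite /bernoulli_percolation.
have [idx idx_inj] := countable_cayley_edges finS genS.
apply: xgetPex; eexists; exact: (realization_bernoulli p01 idx_inj).
Qed.

Lemma is_bernoulli_percolation_unique (gT : groupType) (S : set gT)
    (R : realType) (p : R) (P Q : probability (config S) R) :
  is_bernoulli_percolation p P -> is_bernoulli_percolation p Q ->
  forall A, measurable A -> P A = Q A.
Proof.
move=> bP bQ.
pose cyl : set (set (config S)) :=
  [set C | exists F : seq (cayley_edges S), C = [set w : config S | forall e, e \in F -> w e]].
have cylE (F : seq (cayley_edges S)) :
    [set w : config S | forall e, e \in F -> w e] =
    [set w : config S | forall e, e \in undup F -> w e = true].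
  by apply/seteqP; split=> w h e => [|eF]; [rewrite mem_undup|];
     apply: h; rewrite ?mem_undup.
have mcyl : cyl `<=` measurable.
  move=> _ [F ->].
  rewrite (_ : [set _ | _] = \bigcap_(e in [set` F]) [set w : config S | w e]) //.
  apply: fin_bigcap_measurable => // e _; apply: sub_sigma_algebra.
  by exists e.
move=> A mA.
apply: (@g_sigma_algebra_measure_unique _ _ _ cyl _ (fun=> setT) _ _ P Q) => //.
- by move=> _; exists [::]; apply/seteqP; split.
- by rewrite bigcup_const//; exists 0%N.
- move=> _ _ [F ->] [F' ->]; exists (F ++ F'); apply/seteqP; split=> w.
    by move=> [h h'] e; rewrite mem_cat => /orP[/h|/h'].
  by move=> h; split=> e eF; apply: h; rewrite mem_cat eF ?orbT.
- move=> _ [F ->]; rewrite cylE.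
  have := bP (undup F) xpredT (undup_uniq F).
  by have <- := bQ (undup F) xpredT (undup_uniq F).
- by move=> _; apply: (@le_lt_trans _ _ 1%E); [exact: probability_le1|exact: ltry].
- move: A mA; apply: smallest_sub; first exact: smallest_sigma_algebra.
  move=> _ [e _ <-]; apply: sub_sigma_algebra; exists [:: e].
  apply/seteqP; split=> w; first by move=> we e'; rewrite inE => /eqP->.
  by apply; rewrite mem_head.
Qed.

(* Main.v *)
Require Import Defs.
From HB Require Import structures.
From Stdlib Require Import Relation_Operators Operators_Properties.
From mathcomp Require Import all_boot all_order all_algebra.
From mathcomp Require Import all_classical all_reals all_analysis.
From mathcomp Require Import ring lra.
(* Again, so that [cluster] is a percolation cluster and not a set of cluster
   points. *)
Require Import Defs.

(** Left translations preserve the Bernoulli measure, and opening an edge preserves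
    almost sure properties as soon as [p > 0], which holds if there are infinite
    clusters.

    Suppose that a.s. there is a unique [H2]-infinite cluster. An [H1]-infinite
    cluster is [H2]-infinite, so there is at most one. All elements of [H1] lie in
    the [H2]-infinite cluster with the same positive probability, so with positive
    probability infinitely many of them do, and by the zero-one law for
    [H1]-invariant events there is a.s. an [H1]-infinite cluster
    ([ae_unique_subgroup]).

    Suppose conversely that a.s. there is a unique [H1]-infinite cluster. By
    translation there is a unique [sH1]-infinite cluster for each [s] in [H2].
    If it were a.s. not the [H1]-infinite one then opening the edges of a finite
    path would join the two with positive probability; and whether the two
    coincide is invariant under the translations by the intersection of [H1] and
    [sH1s^-1], which is infinite because [H1] is [s]-normal. So they coincide
    a.s. ([ae_same_cluster]). Call a cluster heavy if it is [sH1]-infinite for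
    some [s] in [H2]: heaviness is invariant under [H2] and there is a.s. exactly
    one heavy cluster. It remains to exclude light clusters, those that are
    [H2]-infinite and not heavy ([ae_no_light]).

    If light clusters exist, openings along a path show that for some oriented
    edge [(u0, v0)] it has positive probability that [u0] is in a light cluster
    and [v0] in the heavy one. By the zero-one law some translate under [H2] of
    that edge has this property a.s.; open it. Almost surely there is again such a
    translate; open it too. Now both edges are good: they are cut edges of the
    heavy cluster whose deletion separates a branch that is light from a part that
    is heavy. The vertices of [H2] in the first light cluster belong to the
    branch of the first edge but not to that of the second.

    This contradicts what mass transport over [H2] says of the good translates of
    an edge. Branches are nested or disjoint ([branch_laminar]), so the good edges
    form a forest ordered by inclusion. Sending mass from each vertex to the
    smallest branch that contains it shows that a branch contains only finitely
    many vertices of [H2] outside of its sub-branches ([ae_finite_first]). As it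
    contains infinitely many, it has a child. Sending mass from each good edge to
    one child shows that a.s. all the good edges are reached: each is the only
    child of some parent ([ae_parent]). Hence good edges form lines, and going up
    a line adds only finitely many vertices of [H2] at each step
    ([line_like_finite]). *)

Set Implicit Arguments.
Unset Strict Implicit.
Unset Printing Implicit Defensive.

Import Order.TTheory GRing.Theory Num.Theory.
Import numFieldNormedType.Exports.

Local Open Scope classical_set_scope.
Local Open Scope ring_scope.

(** * Measurable events and almost sure properties *)

Section Events.
Context d (T : measurableType d).

Definition event (Q : T -> Prop) := measurable [set w | Q w].

Lemma event_cst (Q : Prop) : event (fun=> Q).
Proof.
rewrite /event; have [q|nq] := pselect Q.
  by rewrite (_ : [set _ | _] = setT) //; apply/seteqP; split.
by rewrite (_ : [set _ | _] = set0) //; apply/seteqP; split.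
Qed.

Lemma event_not Q : event Q -> event (fun w => ~ Q w).
Proof. exact: measurableC. Qed.

Lemma event_and Q1 Q2 : event Q1 -> event Q2 -> event (fun w => Q1 w /\ Q2 w).
Proof. exact: measurableI. Qed.

Lemma event_or Q1 Q2 : event Q1 -> event Q2 -> event (fun w => Q1 w \/ Q2 w).
Proof. exact: measurableU. Qed.

Lemma event_imp Q1 Q2 : event Q1 -> event Q2 -> event (fun w => Q1 w -> Q2 w).
Proof.
move=> m1 m2; rewrite /event (_ : [set w | _] = [set w | ~ Q1 w \/ Q2 w]).
  by apply: event_or => //; exact: event_not.
apply/seteqP; split=> w /= h; last by case: h.
by have [/h|] := pselect (Q1 w); [right|left].
Qed.

Lemma event_ex I (Q : I -> T -> Prop) : countable [set: I] ->
  (forall i, event (Q i)) -> event (fun w => exists i, Q i w).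
Proof.
move=> cI mQ; rewrite /event (_ : [set w | _] = \bigcup_i [set w | Q i w]).
  exact: countable_bigcupT_measurable.
by apply/seteqP; split=> w /= [i]; [exists i|move=> _; exists i].
Qed.

Lemma event_all I (Q : I -> T -> Prop) : countable [set: I] ->
  (forall i, event (Q i)) -> event (fun w => forall i, Q i w).
Proof.
move=> cI mQ.
rewrite /event (_ : [set w | _] = [set w | ~ exists i, ~ Q i w]).
  by apply: event_not; apply: event_ex => // i; exact: event_not.
apply/seteqP; split=> w /= h; first by case=> i; apply.
by move=> i; apply: contrapT => nq; apply: h; exists i.
Qed.

Lemma event_ext Q1 Q2 : (forall w, Q1 w <-> Q2 w) -> event Q1 -> event Q2.
Proof.
by move=> e; rewrite /event (_ : [set w | Q1 w] = [set w | Q2 w]) //;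
  apply/seteqP; split=> w /e.
Qed.

Context (R : realType) (P : probability T R).

Lemma ae_all I (Q : I -> T -> Prop) : countable [set: I] ->
  (forall i, {ae P, forall w, Q i w}) -> {ae P, forall w, forall i, Q i w}.
Proof.
move=> /countable_injP[f finj] aeQ.
have : {ae P, forall w, forall n : nat, forall i, f i = n -> Q i w}.
  apply: ae_foralln => n.
  have [[i fi]|no] := pselect (exists i, f i = n).
    apply: filterS (aeQ i) => w Qi j fj.
    by rewrite (finj j i) ?inE // fj.
  by apply/aeW => w i fi; case: no; exists i.
by apply: filterS => w Qw i; exact: (Qw (f i)).
Qed.

Lemma ae_prob0 Q : event Q -> {ae P, forall w, ~ Q w} <-> P [set w | Q w] = 0%E.
Proof.
move=> mQ; rewrite -(negligibleP _ mQ) /=.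
by rewrite /prop_near1 /= /almost_everywhere /= /nbhs/= (_ : ~` _ = [set w | Q w]) //;
  apply/seteqP; split=> w /=; rewrite notK.
Qed.

Lemma ae_prob1 Q : event Q -> P [set w | Q w] = 1%E -> {ae P, forall w, Q w}.
Proof.
move=> mQ P1; have : {ae P, forall w, ~ ~ Q w}.
  apply/ae_prob0; first exact: event_not.
  have -> : [set w | ~ Q w] = ~` [set w | Q w] by [].
  by rewrite probability_setC // P1 subee.
by apply: filterS => w /contrapT.
Qed.

Lemma ae_sat Q : {ae P, forall w, Q w} -> exists w, Q w.
Proof.
move=> aeQ; apply: contrapT => nQ.
have /ae_prob0 : {ae P, forall w : T, ~ True}.
  by apply: filterS aeQ => w Qw; case: nQ; exists w.
rewrite (_ : [set _ | _] = setT); last by apply/seteqP; split.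
rewrite probability_setT => /(_ (event_cst True)) /eqP.
by rewrite onee_eq0.
Qed.

Lemma prob_eq_ae (Q1 Q2 : T -> Prop) : event Q1 -> event Q2 ->
  {ae P, forall w, Q1 w <-> Q2 w} -> P [set w | Q1 w] = P [set w | Q2 w].
Proof.
move=> m1 m2 [N [mN N0 sub]].
apply/eqP; rewrite eq_le.
have le A B : measurable A -> measurable B -> (A `<=` B `|` N) -> (P A <= P B)%E.
  move=> mA mB AB; rewrite -(measureU0 mB mN N0).
  by apply: le_measure; rewrite ?inE //; exact: measurableU.
apply/andP; split; apply: le => // w /= Qw.
  have [Q2w|nQ2] := pselect (Q2 w); [by left|right].
  by apply: sub => /= -[/(_ Qw)].
have [Q1w|nQ1] := pselect (Q1 w); [by left|right].
by apply: sub => /= -[_ /(_ Qw)].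
Qed.

End Events.

(** * Translating and modifying configurations *)

Section Surgery.
Context (gT : groupType) (S : set gT).
Local Notation edge := (cayley_edges S).
Local Notation config := (config S).

Definition ins (e : edge) (w : config) : config := fun e' => (e' == e) || w e'.
Definition del (e : edge) (w : config) : config := fun e' => (e' != e) && w e'.

Lemma cayley_edges_mul h (e : set gT) :
  cayley_edges S e -> cayley_edges S [set (h * x)%g | x in e].
Proof.
move=> [g [s [Ss s1 ->]]]; exists (h * g)%g, s; split => //.
by rewrite image_setU !image_set1 mulgA.
Qed.

Definition edge_mul h (e : edge) : edge :=
  SigSub (mem_set (cayley_edges_mul h (set_mem (valP e)))).

Lemma val_edge_mul h e : val (edge_mul h e) = [set (h * x)%g | x in val e].
Proof. by []. Qed.

Lemma edge_mulM g h e : edge_mul g (edge_mul h e) = edge_mul (g * h)%g e.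
Proof.
apply: val_inj; rewrite !val_edge_mul image_comp.
by apply: eq_imagel => x _ /=; rewrite mulgA.
Qed.

Lemma edge_mul1 e : edge_mul 1%g e = e.
Proof.
apply: val_inj; rewrite val_edge_mul -[RHS]image_id.
by apply: eq_imagel => x _ /=; rewrite mul1g.
Qed.

Lemma edge_mulK h : cancel (edge_mul h) (edge_mul h^-1%g).
Proof. by move=> e; rewrite edge_mulM mulVg edge_mul1. Qed.

Lemma edge_mulVK h : cancel (edge_mul h^-1%g) (edge_mul h).
Proof. by move=> e; rewrite edge_mulM mulgV edge_mul1. Qed.

Definition shift (h : gT) (w : config) : config := fun e => w (edge_mul h^-1%g e).

Lemma shiftK h w : shift h^-1%g (shift h w) = w.
Proof. by apply/funext => e; rewrite /shift invgK edge_mulM mulVg edge_mul1. Qed.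

Lemma shiftVK h w : shift h (shift h^-1%g w) = w.
Proof. by rewrite -{1}(invgK h) shiftK. Qed.

Lemma shift_ins h e w : shift h (ins e w) = ins (edge_mul h e) (shift h w).
Proof.
apply/funext => e'; rewrite /shift /ins; congr (_ || _).
by apply/eqP/eqP => [<-|->]; rewrite ?edge_mulVK ?edge_mulK.
Qed.

Lemma shift_del h e w : shift h (del e w) = del (edge_mul h e) (shift h w).
Proof.
apply/funext => e'; rewrite /shift /del; congr (~~ _ && _).
by apply/eqP/eqP => [<-|->]; rewrite ?edge_mulVK ?edge_mulK.
Qed.

Lemma del_ins_closed e w : ~~ w e -> del e (ins e w) = w.
Proof.
move=> /negbTE we; apply/funext => e'; rewrite /del /ins.
by case: eqP => [->|]//=; rewrite we.
Qed.

Lemma del_ins_neq e f w : e != f -> ~~ w e -> del e (ins f (ins e w)) = ins f w.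
Proof.
move=> /negbTE ef /negbTE we; apply/funext => e'; rewrite /del /ins.
by case: (eqVneq e' e) => [->|]//=; rewrite we ef.
Qed.

Lemma event_open (e : edge) : event (fun w : config => w e : Prop).
Proof. by apply: sub_sigma_algebra; exists e. Qed.

Lemma measurable_to_config d (T : measurableType d) (f : T -> config) :
  (forall e, event (fun w => f w e : Prop)) -> measurable_fun setT f.
Proof.
move=> mf; apply: (@measurability _ _ _ config setT f (@open_events gT S)) => //.
by move=> _ [_ [e _ <-] <-]; rewrite setTI; exact: mf.
Qed.

Lemma event_comp d (T : measurableType d) (f : T -> config) (Q : config -> Prop) :
  measurable_fun setT f -> event Q -> event (fun w => Q (f w)).
Proof. by move=> mf mQ; have := mf measurableT _ mQ; rewrite setTI. Qed.

Lemma measurable_ins e : measurable_fun setT (ins e).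
Proof.
apply: measurable_to_config => e'; rewrite /ins; case: eqP => _ /=.
  exact: event_cst.
exact: event_open.
Qed.

Lemma measurable_del e : measurable_fun setT (del e).
Proof.
apply: measurable_to_config => e'; rewrite /del; case: eqP => _ /=.
  exact: event_cst.
exact: event_open.
Qed.

Lemma measurable_shift h : measurable_fun setT (shift h).
Proof. by apply: measurable_to_config => e; exact: event_open. Qed.

End Surgery.

Section BernoulliSurgery.
Context (gT : groupType) (S : set gT) (R : realType) (p : R).
Context (P : probability (config S) R).
Hypothesis p01 : 0 <= p <= 1.
Hypothesis bP : is_bernoulli_percolation p P.
Local Notation edge := (cayley_edges S).
Local Notation config := (config S).

HB.instance Definition _ h :=
  isMeasurableFun.Build _ _ _ _ (@shift gT S h) (measurable_shift h).
HB.instance Definition _ e :=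
  isMeasurableFun.Build _ _ _ _ (@ins gT S e) (measurable_ins e).
HB.instance Definition _ e :=
  isMeasurableFun.Build _ _ _ _ (@del gT S e) (measurable_del e).

Lemma prob_shift h (Q : config -> Prop) : event Q ->
  P [set w | Q (shift h w)] = P [set w | Q w].
Proof.
move=> mQ.
have bQ : is_bernoulli_percolation p (distribution P (@shift gT S h) : probability config R).
  move=> F c uF; rewrite /distribution /pushforward /=.
  have := bP (fun e => c (edge_mul h e)) (F := map (edge_mul h^-1%g) F).
  rewrite map_inj_uniq; last exact: (can_inj (edge_mulVK h)).
  move=> /(_ uF); rewrite big_map.
  under [in RHS]eq_bigr do rewrite edge_mulVK.
  move=> <-; congr (P _); apply/seteqP; split => w /= wF e.
    by move=> /mapP[e' e'F ->]; rewrite edge_mulVK; exact: wF.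
  by move=> eF; rewrite /shift wF ?edge_mulVK //; exact: map_f.
exact: (is_bernoulli_percolation_unique bQ bP).
Qed.

Lemma ae_shift h (Q : config -> Prop) :
  {ae P, forall w, Q w} -> {ae P, forall w, Q (shift h w)}.
Proof.
move=> [N [mN N0 sub]]; exists [set w | N (shift h w)]; split.
- exact: (event_comp (measurable_shift h) mN).
- by rewrite (prob_shift h mN).
- by move=> w /= nQ; exact: sub.
Qed.

Let p_nng : {nonneg R} := NngNum (proj1 (andP p01)).
Let q_ge0 : 0 <= 1 - p.
Proof. by rewrite subr_ge0; have /andP[] := p01. Qed.
Let q_nng : {nonneg R} := NngNum q_ge0.

(** The law of a configuration in which the edge [e] has been resampled. *)
Let resampled (e : edge) : set config -> \bar R :=
  measure_add (mscale p_nng (distribution P (@ins gT S e)))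
              (mscale q_nng (distribution P (@del gT S e))).

HB.instance Definition _ e := Measure.on (resampled e).

Let resampledE e (Q : set config) : resampled e Q =
  (p%:E * P [set w | Q (ins e w)] + (1 - p)%:E * P [set w | Q (del e w)])%E.
Proof. exact: measure_addE. Qed.

Let resampledT e : resampled e setT = 1%E.
Proof.
rewrite resampledE (_ : [set w | _] = setT) // probability_setT.
by rewrite !mule1 -EFinD; congr EFin; lra.
Qed.

HB.instance Definition _ e :=
  Measure_isProbability.Build _ _ _ (resampled e) (resampledT e).

(** The law of a configuration with [e] resampled independently is again Bernoulli.
    Insertion tolerance and the independence of distinct edges both follow from
    this identity. *)
Lemma resample e (Q : config -> Prop) : event Q ->
  (P [set w | Q w] =
   p%:E * P [set w | Q (ins e w)] + (1 - p)%:E * P [set w | Q (del e w)])%E.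
Proof.
move=> mQ; rewrite -(resampledE e [set w | Q w]).
apply: (@is_bernoulli_percolation_unique _ _ _ p P (resampled e)) => // F c uF.
apply: (eq_trans (resampledE e _)).
have cyl (F' : seq edge) : uniq F' -> P [set w | forall e', e' \in F' -> w e' = c e'] =
   (\prod_(e' <- F') bernoulli_pmf p (c e'))%:E by move=> uF'; exact: bP.
have [eF|eF] := boolP (e \in F); last first.
  rewrite (_ : [set w | _] = [set w | forall e', e' \in F -> w e' = c e']); last first.
    apply/seteqP; split=> w /= h e' e'F; have := h _ e'F; rewrite /ins;
    by case: eqP => // ee; rewrite ee (negbTE eF) in e'F.
  rewrite (_ : [set w | forall e', _ -> del e w e' = _] =
     [set w | forall e', e' \in F -> w e' = c e']); last first.
    apply/seteqP; split=> w /= h e' e'F; have := h _ e'F; rewrite /del;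
    by case: eqP => // ee; rewrite ee (negbTE eF) in e'F.
  by rewrite !cyl // -!EFinM -EFinD; congr EFin; lra.
rewrite (big_rem e) //=.
have uF' : uniq (rem e F) by exact: rem_uniq.
have memF' e' : (e' \in rem e F) = (e' != e) && (e' \in F).
  by rewrite (mem_rem_uniq e uF).
case ce : (c e) => /=.
  rewrite (_ : [set w | _] = [set w | forall e', e' \in rem e F -> w e' = c e']); last first.
    apply/seteqP; split=> w /= h e'.
      by rewrite memF' => /andP[ne e'F]; have := h _ e'F; rewrite /ins (negbTE ne).
    move=> e'F; rewrite /ins; case: eqVneq => [->//|ne] /=.
    by apply: h; rewrite memF' ne.
  rewrite (_ : [set w | forall e', _ -> del e w e' = _] = set0); last first.
    by apply/seteqP; split=> w //= /(_ _ eF); rewrite /del eqxx ce.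
  by rewrite measure0 mule0 adde0 cyl // EFinM.
rewrite (_ : [set w | forall e', _ -> ins e w e' = _] = set0); last first.
  by apply/seteqP; split=> w //= /(_ _ eF); rewrite /ins eqxx ce.
rewrite (_ : [set w | _] = [set w | forall e', e' \in rem e F -> w e' = c e']); last first.
  apply/seteqP; split=> w /= h e'.
    by rewrite memF' => /andP[ne e'F]; have := h _ e'F; rewrite /del ne.
  move=> e'F; rewrite /del; case: eqVneq => [->//|ne] /=.
  by apply: h; rewrite memF' ne.
by rewrite measure0 mule0 add0e cyl // EFinM.
Qed.

(** Insertion tolerance: opening an edge cannot charge a null event. *)
Lemma ae_ins e (Q : config -> Prop) : 0 < p ->
  {ae P, forall w, Q w} -> {ae P, forall w, Q (ins e w)}.
Proof.
move=> p0 [N [mN N0 sub]]; exists [set w | N (ins e w)]; split.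
- exact: (event_comp (measurable_ins e) mN).
- have := resample e mN; rewrite (_ : [set w | N w] = N) // N0 => /esym/eqP.
  rewrite padde_eq0; last 2 first.
  + by rewrite mule_ge0 // lee_fin; have /andP[] := p01.
  + by rewrite mule_ge0 // lee_fin.
  by move=> /andP[+ _]; rewrite mule_eq0 eqe gt_eqF // => /eqP.
- by move=> w /= nQ; exact: sub.
Qed.

End BernoulliSurgery.

(** * A zero-one law for translations *)

Section ZeroOne.
Context (gT : groupType) (S : set gT) (R : realType) (p : R).
Context (P : probability (config S) R).
Hypothesis p01 : 0 <= p <= 1.
Hypothesis bP : is_bernoulli_percolation p P.
Local Notation edge := (cayley_edges S).
Local Notation config := (config S).
Implicit Types (A B D : config -> Prop) (F : seq edge).

Definition supported F B :=
  forall w w' : config, (forall e, e \in F -> w e = w' e) -> B w -> B w'.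

(** The edges of [F] are resampled one after the other; the event [D] does not
    notice it, and in the end the event [B] is decided. *)
Lemma supported_indep F B D : event B -> event D -> supported F B ->
  (forall e w, e \in F -> D (ins e w) <-> D w) ->
  (P [set w | B w /\ D w] = P [set w | B w] * P [set w | D w])%E.
Proof.
elim: F B => [|e F IH] B mB mD sB insD.
  have [[w0 Bw0]|nB] := pselect (exists w, B w).
    have BE : [set w | B w] = setT by apply/seteqP; split=> w // _; exact: (sB w0).
    rewrite (_ : [set w | _ /\ _] = [set w | B w] `&` [set w | D w]) //.
    by rewrite BE setTI probability_setT mul1e.
  have BE : [set w | B w] = set0 by apply/seteqP; split=> w //= Bw; case: nB; exists w.
  rewrite (_ : [set w | _ /\ _] = [set w | B w] `&` [set w | D w]) //.
  by rewrite BE set0I measure0 mul0e.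
have delD w : D (del e w) <-> D w.
  rewrite -(insD e) ?mem_head // -(insD e w) ?mem_head //.
  suff -> : ins e (del e w) = ins e w by [].
  by apply/funext => e'; rewrite /ins /del; case: eqP.
have insE w : D (ins e w) <-> D w by apply: insD; rewrite mem_head.
have IH' (f : config -> config) : measurable_fun setT f ->
    (forall w w', (forall e', e' \in F -> w e' = w' e') ->
       forall e', e' \in e :: F -> f w e' = f w' e') ->
    (P [set w | B (f w) /\ D w] = P [set w | B (f w)] * P [set w | D w])%E.
  move=> mf fF; apply: (IH (B \o f)) => //.
  - exact: (event_comp mf mB).
  - by move=> w w' /fF ww'; exact: sB.
  - by move=> e' w e'F; apply: insD; rewrite inE e'F orbT.
rewrite (resample p01 bP e); last exact: event_and.
rewrite [X in (_ = X * _)%E](resample p01 bP e) //.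
rewrite (_ : [set w | _ /\ _] = [set w | B (ins e w) /\ D w]); last first.
  by apply/seteqP; split=> w /=; rewrite insE.
rewrite (_ : [set w | B (del e w) /\ _] = [set w | B (del e w) /\ D w]); last first.
  by apply/seteqP; split=> w /=; rewrite delD.
rewrite (IH' (ins e)); last 2 first.
- exact: measurable_ins.
- by move=> w w' ww' e'; rewrite inE /ins; case: eqVneq => //= _ /ww'.
rewrite (IH' (del e)); last 2 first.
- exact: measurable_del.
- by move=> w w' ww' e'; rewrite inE /del; case: eqVneq => //= _ /ww'.
by rewrite !muleA -ge0_muleDl // mule_ge0 // lee_fin;
  have /andP[? ?] := p01; rewrite ?subr_ge0.
Qed.

Definition differ A B : config -> Prop := fun w => ~ (A w <-> B w).

Lemma event_differ A B : event A -> event B -> event (differ A B).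
Proof.
move=> mA mB; apply: event_not.
by apply: event_and; exact: event_imp.
Qed.

Lemma differ_dist A B (eps : R) : event A -> event B ->
  (P [set w | differ A B w] <= eps%:E)%E ->
  `|fine (P [set w | A w]) - fine (P [set w | B w])| <= eps.
Proof.
move=> mA mB le_eps.
have mdiff := event_differ mA mB.
have fin (C : config -> Prop) : event C -> (fine (P [set w | C w]))%:E = P [set w | C w].
  by move=> mC; rewrite fineK // fin_num_measure.
have half (C C' : config -> Prop) : event C -> event C' ->
    (forall w, C w -> C' w \/ differ A B w) ->
    fine (P [set w | C w]) - fine (P [set w | C' w]) <= eps.
  move=> mC mC' sub; rewrite lerBlDl -lee_fin EFinD !fin //.
  apply: (le_trans _ (leeD2l _ le_eps)).
  apply: (le_trans _ (measureU2 _ mC' mdiff)).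
  by apply: le_measure; rewrite ?inE //; exact: measurableU.
rewrite ler_norml; apply/andP; split; last first.
  apply: half => // w Aw; have [|nB] := pselect (B w); [by left|right].
  by case=> /(_ Aw).
rewrite lerNl opprB; apply: half => // w Bw.
by have [|nA] := pselect (A w); [left|right; case=> _ /(_ Bw)].
Qed.

Definition approximable A := event A /\ forall eps : R, 0 < eps ->
  exists F B, [/\ event B, supported F B &
    (P [set w | differ A B w] <= eps%:E)%E].

Lemma approximable_not A : approximable A -> approximable (fun w => ~ A w).
Proof.
move=> [mA apA]; split; first exact: event_not.
move=> eps eps0; have [F [B [mB sB le]]] := apA eps eps0.
exists F, (fun w => ~ B w); split; first exact: event_not.
  by move=> w w' ww' nB /sB Bw; apply/nB/Bw => e /ww' ->.
rewrite (_ : [set w | _] = [set w | differ A B w]) //.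
apply/seteqP; split=> w /= nAB h; apply: nAB.
  by split=> nX Y; apply: nX; apply h.
by split=> ?; apply: contrapT => ?; case: h => h1 h2; [apply: h2|apply: h1].
Qed.

Lemma approximable_or A A' :
  approximable A -> approximable A' -> approximable (fun w => A w \/ A' w).
Proof.
move=> [mA apA] [mA' apA']; split; first exact: event_or.
move=> eps eps0; have e2 : 0 < eps / 2 by rewrite divr_gt0.
have [F [B [mB sB le]]] := apA _ e2.
have [F' [B' [mB' sB' le']]] := apA' _ e2.
exists (F ++ F'), (fun w => B w \/ B' w); split; first exact: event_or.
  move=> w w' ww' [Bw|B'w]; [left; apply: sB Bw|right; apply: sB' B'w];
  by move=> e eF; apply: ww'; rewrite mem_cat eF ?orbT.
rewrite (splitr eps) EFinD; apply: (le_trans _ (leeD le le')).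
apply: (le_trans _ (measureU2 _ (event_differ mA mB) (event_differ mA' mB'))).
apply: le_measure; rewrite ?inE.
- by apply: event_differ; exact: event_or.
- by apply: measurableU; exact: event_differ.
move=> w /= nAB; apply: contrapT => /not_orP[/contrapT AB /contrapT AB'].
by apply: nAB; rewrite AB AB'.
Qed.

Lemma approximable_ex (A : nat -> config -> Prop) :
  (forall n, approximable (A n)) -> approximable (fun w => exists n, A n w).
Proof.
move=> apA; have mA n : event (A n) by have [] := apA n.
have mU : event (fun w => exists n, A n w) by exact: event_ex.
split => // eps eps0; have e2 : 0 < eps / 2 by rewrite divr_gt0.
pose U n w := exists2 i, (i < n)%N & A i w.
have apU n : approximable (U n).
  elim: n => [|n IH].
    have -> : U 0%N = fun=> False.
      by apply/funext => w; apply/propext; split=> // -[].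
    split; first exact: event_cst.
    move=> e e0; exists [::], (fun=> False); split=> //; first exact: event_cst.
    rewrite (_ : [set w | _] = set0) ?measure0 ?lee_fin ?ltW //.
    by apply/seteqP; split=> w //=; rewrite /differ; apply.
  have -> : U n.+1 = fun w => U n w \/ A n w.
    apply/funext => w; apply/propext; split=> [[i]|[[i iN Ai]|An]].
    - by rewrite ltnS leq_eqVlt => /orP[/eqP->|]; [right|left; exists i].
    - by exists i => //; exact: leqW.
    - by exists n.
  exact: approximable_or.
have mUn n : event (U n) by have [] := apU n.
pose G n := [set w : config | (exists i, A i w) /\ ~ U n w].
have mG n : measurable (G n) by apply: event_and => //; exact: event_not.
have cG : \bigcap_n G n = set0.
  apply/seteqP; split=> w //= Gw; have [[i Ai] _] := Gw 0%N I.
  by have [_] := Gw i.+1 I; apply; exists i.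
have : P (G n) @[n --> \oo] --> P (\bigcap_n G n).
  apply: nonincreasing_cvg_mu => //.
  - exact: le_lt_trans (probability_le1 P (mG _)) (ltry _).
  - by rewrite cG.
  - move=> m n mn; apply/subsetPset => w [Aw nU]; split=> // -[i im Ai].
    by apply: nU; exists i => //; exact: leq_trans mn.
rewrite cG measure0 => /fine_cvgP[_ /cvgrPdist_lt /(_ _ e2)[N _ /(_ N (leqnn N))]].
rewrite /= sub0r normrN ger0_norm ?fine_ge0 // => /ltW GN.
have {}GN : (P (G N) <= (eps / 2)%:E)%E by rewrite -lee_fin fineK ?fin_num_measure in GN.
have [_ /(_ _ e2)[F [B [mB sB le]]]] := apU N.
exists F, B; split=> //.
rewrite (splitr eps) EFinD; apply: (le_trans _ (leeD GN le)).
apply: (le_trans _ (measureU2 _ (mG N) (event_differ (mUn N) mB))).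
apply: le_measure; rewrite ?inE; first exact: event_differ.
  by apply: measurableU => //; exact: event_differ.
move=> w /= nAB; have [Uw|nU] := pselect (U N w).
  right=> UB; apply: nAB; split=> [_|_]; first exact/UB.
  by have [i _] := Uw; exists i.
have [Aw|nA] := pselect (exists n, A n w); first by left.
right=> UB; apply: nAB; split=> // Bw; exfalso; exact/nU/UB.
Qed.

(** The approximable events form a sigma-algebra, and the opening of an edge is one
    of them. *)
Lemma event_approximable A : event A -> approximable A.
Proof.
move=> mA; suff : [set w | A w] \in [set A : set config | approximable A].
  by rewrite inE.
apply/mem_set; move: mA; rewrite /event; apply: smallest_sub.
  split=> /=.
  - split; first exact: measurable0.
    move=> e e0; exists [::], (fun=> False); split=> //; first exact: event_cst.
    rewrite (_ : [set w | _] = set0) ?measure0 ?lee_fin ?ltW //.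
    by apply/seteqP; split=> w //=; rewrite /differ; apply.
  - by move=> B /approximable_not; rewrite setTD.
  - move=> C /approximable_ex; rewrite (_ : (fun w => _) = \bigcup_n C n) //.
    apply/funext => w; apply/propext; split=> [[n ?]|[n _ ?]]; by exists n.
move=> _ [e _ <-] /=; split; first exact: event_open.
move=> eps eps0; exists [:: e], (fun w : config => w e); split.
- exact: event_open.
- by move=> w w' /(_ e (mem_head _ _)) ->.
- rewrite (_ : [set w | _] = set0) ?measure0 ?lee_fin ?ltW //.
  by apply/seteqP; split=> w //=; rewrite /differ; apply.
Qed.

(** The translation is determined by one endpoint of an edge and its image, both of
    which are endpoints of edges of [F]. *)
Lemma finite_edge_hits F :
  finite_set [set h : gT | exists2 e, e \in F & edge_mul h e \in F].
Proof.
have end_ (e : edge) : exists xy : gT * gT, val e = [set xy.1; xy.2].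
  by have [g [s [_ _ ->]]] := set_mem (valP e); exists (g, (g * s)%g).
have [ends endsE] := choice end_.
pose V := [seq (ends e).1 | e <- F] ++ [seq (ends e).2 | e <- F].
apply: (@sub_finite_set _ _ [set` [seq (y * x^-1)%g | x <- V, y <- V]]); last first.
  exact: finite_seq.
move=> h [e eF heF] /=.
have : val (edge_mul h e) (h * (ends e).1)%g.
  by exists (ends e).1 => //; rewrite endsE; left.
rewrite endsE => hx; apply/allpairsP; exists ((ends e).1, h * (ends e).1)%g.
split; [|rewrite /= |by rewrite /= mulgK].
  by rewrite mem_cat (map_f (fun e => (ends e).1) eF).
rewrite mem_cat; case: hx => /= ->.
  by rewrite (map_f (fun e => (ends e).1) heF).
by rewrite (map_f (fun e => (ends e).2) heF) orbT.
Qed.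

(** An approximation [B] of [A] on finitely many edges is independent of its
    translate by [h] when [h] moves these edges off themselves, as infinitely many
    translations in [I] do. Both approximate [A], so [P(A) = P(A)^2]. *)
Lemma zero_one (I : set gT) A : infinite_set I -> event A ->
  (forall h w, I h -> A (shift h w) <-> A w) ->
  P [set w | A w] = 0%E \/ P [set w | A w] = 1%E.
Proof.
move=> infI mA invA; set x := P _.
have xE : (fine x)%:E = x by rewrite fineK // fin_num_measure.
have bounds (C : config -> Prop) : event C -> 0 <= fine (P [set w | C w]) <= 1.
  move=> mC; rewrite fine_ge0 //= -lee_fin fineK ?fin_num_measure //.
  exact: probability_le1.
suff : fine x = fine x ^+ 2.
  move=> e; have /eqP : fine x * (1 - fine x) = 0 by rewrite mulrBr mulr1 -expr2 -e subrr.
  rewrite mulf_eq0 subr_eq0 => /orP[/eqP x0|/eqP x1].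
    by left; rewrite -xE x0.
  by right; rewrite -xE -x1.
apply/eqP; rewrite -subr_eq0 -normr_le0; apply/ler_addgt0Pr => eps eps0.
rewrite add0r; have d0 : 0 < eps / 4 by rewrite divr_gt0.
have [_ /(_ _ d0)[F [B [mB sB le]]]] := event_approximable mA.
(* Only finitely many translations bring an edge of [F] back into [F]. *)
have [h [Ih hF]] : exists h, I h /\ ~ exists2 e, e \in F & edge_mul h e \in F.
  apply: contrapT => no; apply: infI; apply: sub_finite_set (finite_edge_hits F).
  by move=> h Ih /=; apply: contrapT => nh; apply: no; exists h.
pose Bh w := B (shift h w).
have mBh : event Bh by exact: (event_comp (measurable_shift h) mB).
have indep : (P [set w | B w /\ Bh w] = P [set w | B w] * P [set w | B w])%E.
  rewrite (supported_indep mB mBh sB); first by rewrite (prob_shift bP h mB).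
  move=> e w eF; rewrite /Bh shift_ins.
  have nhF : edge_mul h e \notin F by apply/negP => heF; apply: hF; exists e.
  have eq f : f \in F -> ins (edge_mul h e) (shift h w) f = shift h w f.
    by move=> fF; rewrite /ins; case: eqP => // fE; rewrite -fE fF in nhF.
  by split; apply: sB => f /eq.
have d1 := differ_dist mA mB le.
have d2 : `|fine x - fine (P [set w | B w /\ Bh w])| <= eps / 4 + eps / 4.
  apply: differ_dist => //; first exact: event_and.
  have mD := event_differ mA mB.
  have mDh : event (fun w => differ A B (shift h w)).
    exact: (event_comp (measurable_shift h) mD).
  have leh : (P [set w | differ A B (shift h w)] <= (eps / 4)%:E)%E.
    by rewrite (prob_shift bP h mD).
  rewrite EFinD; apply: (le_trans _ (leeD le leh)).
  apply: (le_trans _ (measureU2 _ mD mDh)).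
  apply: le_measure; rewrite ?inE.
  - by apply: event_differ => //; exact: event_and.
  - exact: measurableU.
  move=> w /= nAB; apply: contrapT => /not_orP[/contrapT AB /contrapT].
  rewrite invA // => AB'; apply: nAB; rewrite /Bh -AB -AB'; tauto.
have b01 := bounds B mB; have x01 := bounds A mA.
rewrite indep fineM ?fin_num_measure // in d2.
move: d1 d2 b01 x01; rewrite -/x; move: (fine x) (fine (P _)) => u b.
rewrite !ler_norml => /andP[? ?] /andP[? ?] /andP[? ?] /andP[? ?].
by apply/andP; split; nra.
Qed.

End ZeroOne.

(** * Clusters *)

Lemma infinite_setP_seq (T : eqType) (A : set T) :
  infinite_set A <-> forall l : seq T, exists2 y, A y & y \notin l.
Proof.
split=> [infA l|h /finite_seqP[l Al]].
  apply: contrapT => no; apply: infA; apply: (@sub_finite_set _ _ [set` l]).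
    by move=> y Ay /=; apply: contrapT => /negP yl; apply: no; exists y.
  exact: finite_seq.
by have [y Ay] := h l; rewrite Al in Ay; rewrite Ay.
Qed.

Lemma countable_seq (T : choiceType) :
  countable [set: T] -> countable [set: seq T].
Proof.
move=> /countable_injP[f finj].
have finj' : injective f by move=> x y; apply: finj; rewrite inE.
apply/countable_injP; exists (fun l => pickle (map f l)) => l l' _ _.
by move=> /(pcan_inj pickleK)/(inj_map finj').
Qed.

Section Clusters.
Context (gT : groupType) (S : set gT).
Local Notation edge := (cayley_edges S).
Local Notation config := (config S).
Implicit Types (w : config) (x y z : gT) (e : edge) (A : set gT).

Lemma open_adjC w x y : open_adj w x y -> open_adj w y x.
Proof. by move=> [e we ve]; exists e => //; rewrite setUC. Qed.

Lemma conn_refl w x : cluster w x x.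
Proof. exact: rt_refl. Qed.

Lemma conn_trans w x y z : cluster w x y -> cluster w y z -> cluster w x z.
Proof. exact: rt_trans. Qed.

Lemma conn_sym w x y : cluster w x y -> cluster w y x.
Proof.
elim=> [a b /open_adjC|a|a b c _ ba _ cb]; first exact: rt_step.
  exact: rt_refl.
exact: rt_trans cb ba.
Qed.

Lemma open_conn w e x y : w e -> val e = [set x; y] -> cluster w x y.
Proof. by move=> we ve; apply: rt_step; exists e. Qed.

Lemma cluster_eq w x y : cluster w x y -> cluster w x = cluster w y.
Proof.
move=> xy; apply/seteqP; split=> z; last exact: conn_trans.
exact/conn_trans/conn_sym.
Qed.

Lemma conn_ind w x (Q : gT -> Prop) : Q x ->
  (forall y z, cluster w x y -> Q y -> open_adj w y z -> Q z) ->
  forall z, cluster w x z -> Q z.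
Proof.
move=> Qx QS z xz; suff [] : cluster w x z /\ Q z by [].
elim: (clos_rt_rtn1 _ _ _ _ xz) => [|y t yz _ [xy Qy]].
  by split=> //; exact: conn_refl.
split; last exact: QS Qy yz.
by apply: conn_trans xy _; exact: rt_step.
Qed.

(** Paths from [x] stay in the cluster of [x], so only the edges that touch this
    cluster have to be compared. *)
Lemma conn_transfer w w' x :
  (forall y e, cluster w x y -> val e y -> w e -> w' e) ->
  cluster w x `<=` cluster w' x.
Proof.
move=> ww' z xz; elim/conn_ind: xz => [|y {}z xy xy' [e we ve]].
  exact: conn_refl.
apply: conn_trans xy' _; apply: (open_conn (e := e)) => //.
by apply: ww' xy _ we; rewrite ve; left.
Qed.

Lemma conn_mono w w' x : (forall e, w e -> w' e) -> cluster w x `<=` cluster w' x.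
Proof. by move=> ww'; apply: conn_transfer => y e _ _; exact: ww'. Qed.

Lemma conn_insW e w x : cluster w x `<=` cluster (ins e w) x.
Proof. by apply: conn_mono => e' we'; rewrite /ins we' orbT. Qed.

Lemma conn_delW e w x : cluster (del e w) x `<=` cluster w x.
Proof. by apply: conn_mono => e'; rewrite /del => /andP[]. Qed.

Lemma conn_ins_edge e w a b : val e = [set a; b] -> cluster (ins e w) a b.
Proof. by move=> ve; apply: open_conn ve; rewrite /ins eqxx. Qed.

Lemma ends_inj (a b x y : gT) : [set a; b] = [set x; y] ->
  (a = x /\ b = y) \/ (a = y /\ b = x).
Proof.
move=> E.
have : [set x; y] a by rewrite -E; left.
have : [set x; y] b by rewrite -E; right.
have : [set a; b] x by rewrite E; left.
have : [set a; b] y by rewrite E; right.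
by rewrite /=; do 4! case=> ?; subst; auto.
Qed.

Lemma conn_ins_sub e w a b x : val e = [set a; b] ->
  cluster (ins e w) x `<=` cluster w x `|` (cluster w a `|` cluster w b).
Proof.
move=> ve z; elim/conn_ind => [|y {}z xy IH [e' we' ve']].
  by left; exact: conn_refl.
move: we'; rewrite /ins => /orP[/eqP e'e|we'].
  have := ends_inj (etrans (esym ve') (etrans (congr1 val e'e) ve)).
  by case=> -[_ ->]; right; [right|left]; exact: conn_refl.
have yz := open_conn we' ve'.
by case: IH => [?|[?|?]]; [left|right;left|right;right]; apply: conn_trans yz.
Qed.

Lemma conn_ins_off e w a b x : val e = [set a; b] ->
  ~ cluster w x a -> ~ cluster w x b -> cluster (ins e w) x = cluster w x.
Proof.
move=> ve xa xb; apply/seteqP; split; last exact: conn_insW.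
move=> z; elim/conn_ind => [|y {}z _ xy [e' we' ve']]; first exact: conn_refl.
move: we'; rewrite /ins => /orP[/eqP e'e|we'].
  have := ends_inj (etrans (esym ve') (etrans (congr1 val e'e) ve)).
  by case=> -[yE _]; subst y.
exact: conn_trans xy (open_conn we' ve').
Qed.

(** The edges of one path suffice. *)
Lemma conn_finite_support w y z : cluster w y z ->
  exists L : seq edge, forall e, e \notin L -> cluster (del e w) y z.
Proof.
elim/conn_ind=> [|a b _ [L IH] [e we ve]].
  by exists [::] => e _; exact: conn_refl.
exists (e :: L) => e'; rewrite inE negb_or => /andP[e'e /IH ya].
apply: conn_trans ya _; apply: (open_conn (e := e)) => //.
by rewrite /del eq_sym e'e.
Qed.

Lemma open_adj_shift h w x y :
  open_adj (shift h w) (h * x)%g (h * y)%g <-> open_adj w x y.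
Proof.
split=> [[e we ve]|[e we ve]].
  exists (edge_mul h^-1%g e); first exact: we.
  by rewrite val_edge_mul ve image_setU !image_set1 !mulKg.
exists (edge_mul h e); first by rewrite /shift edge_mulK.
by rewrite val_edge_mul ve image_setU !image_set1.
Qed.

Lemma conn_shift h w x y :
  cluster (shift h w) (h * x)%g (h * y)%g <-> cluster w x y.
Proof.
suff imp h' w' x' y' : cluster w' x' y' -> cluster (shift h' w') (h' * x')%g (h' * y')%g.
  by split=> [/(imp h^-1%g)|/imp//]; rewrite shiftK !mulKg.
elim=> [a b ab|a|a b c _ IH1 _]; first by apply: rt_step; apply/open_adj_shift.
  exact: rt_refl.
exact: rt_trans.
Qed.

Lemma rel_infinite_shift h w x A :
  rel_infinite [set (h * y)%g | y in A] (cluster (shift h w) (h * x)%g) <->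
  rel_infinite A (cluster w x).
Proof.
rewrite /rel_infinite (_ : _ `&` _ = [set (h * y)%g | y in cluster w x `&` A]).
  split=> inf fin; apply: inf; first exact: finite_image.
  rewrite (_ : _ `&` _ = [set (h^-1 * y)%g | y in [set (h * y)%g | y in cluster w x `&` A]]).
    exact: finite_image.
  rewrite image_comp -[LHS]image_id; apply: eq_imagel => y _ /=.
  by rewrite mulKg.
apply/seteqP; split=> [_ [/[swap] -[y Ay <-] xy]|_ [y [xy Ay] <-]].
  by exists y => //; split=> //; exact/(conn_shift h).
by split; [apply/conn_shift|exists y].
Qed.

Lemma rel_infiniteS A B w x : (forall y, cluster w x y -> A y -> B y) ->
  rel_infinite A (cluster w x) -> rel_infinite B (cluster w x).
Proof.
move=> AB inf fin; apply: inf; apply: sub_finite_set fin => y [xy /(AB _ xy)].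
by split.
Qed.

Lemma rel_infinite_sub A (K K' : set gT) : K `<=` K' ->
  rel_infinite A K -> rel_infinite A K'.
Proof. by move=> KK' inf fin; apply: inf; apply: (sub_finite_set _ fin); exact: setSI. Qed.

Definition unique_infinite A w :=
  (exists x, rel_infinite A (cluster w x)) /\
  (forall x y, rel_infinite A (cluster w x) -> rel_infinite A (cluster w y) ->
     cluster w x y).

Lemma unique_rel_infiniteP w A :
  (exists! K, is_cluster w K /\ rel_infinite A K) <-> unique_infinite A w.
Proof.
split=> [[K [[[x ->] infx] uniq]]|[[x infx] uniq]].
  split; first by exists x.
  move=> a b infa infb; have Ea : cluster w x = cluster w a.
    by apply: uniq; split=> //; exists a.
  have Eb : cluster w x = cluster w b by apply: uniq; split=> //; exists b.
  by rewrite -Ea Eb; exact: conn_refl.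
exists (cluster w x); split; first by split=> //; exists x.
by move=> _ [[y ->] infy]; apply: cluster_eq; exact: uniq.
Qed.

Hypothesis cG : countable [set: gT].

Lemma event_open_adj x y : event (fun w => open_adj w x y).
Proof.
have [[e ve]|no] := pselect (exists e : edge, val e = [set x; y]).
  apply: event_ext (event_open e) => w; split=> [we|[e' we' ve']].
    by exists e.
  by rewrite (val_inj (etrans ve (esym ve'))).
apply: event_ext (event_cst _ False) => w; split=> // -[e _ ve].
by apply: no; exists e.
Qed.

Lemma event_conn x y : event (fun w => cluster w x y).
Proof.
(* Connection is made measurable by counting the steps of a path. *)
pose fix reach n (w : config) z {struct n} :=
  if n is m.+1 then exists t, reach m w t /\ open_adj w t z else x = z.
apply: (@event_ext _ _ (fun w => exists n, reach n w y)) => [w|].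
  split=> [[n]|xy].
    elim: n y => [z <-|n IH z [t [/IH xt tz]]]; first exact: conn_refl.
    by apply: (conn_trans xt); exact: rt_step.
  elim/conn_ind: xy => [|t z _ [n xt] tz]; first by exists 0%N.
  by exists n.+1, t.
apply: event_ex => // n; elim: n y => [|n IH] y; first exact: event_cst.
by apply: event_ex => // t; apply: event_and => //; exact: event_open_adj.
Qed.

Lemma event_infinite (C : config -> set gT) :
  (forall y, event (fun w => C w y)) -> event (fun w => infinite_set (C w)).
Proof.
move=> mC; apply: (@event_ext _ _ (fun w => forall l : seq gT, exists y, C w y /\ y \notin l)).
  move=> w; split=> [h|/infinite_setP_seq h l].
    by apply/infinite_setP_seq => l; have [y []] := h l; exists y.
  by have [y] := h l; exists y.
apply: event_all; first exact: countable_seq.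
move=> l; apply: event_ex => // y; apply: event_and => //; exact: event_cst.
Qed.

Lemma event_rel_infinite A x : event (fun w => rel_infinite A (cluster w x)).
Proof.
apply: event_infinite => y; apply: event_and; first exact: event_conn.
exact: event_cst.
Qed.

End Clusters.

Lemma subgroupM (gT : groupType) (H : set gT) x y : subgroup H -> H x -> H y -> H (x * y)%g.
Proof.
move=> /group_closedM HM Hx Hy; apply/set_mem/HM; exact/mem_set.
Qed.

Lemma subgroupV (gT : groupType) (H : set gT) x : subgroup H -> H x -> H x^-1%g.
Proof. by move=> /group_closedV HV Hx; apply/set_mem/HV; exact/mem_set. Qed.

Lemma subgroup1 (gT : groupType) (H : set gT) : subgroup H -> H 1%g.
Proof. by move=> [/set_mem]. Qed.

Lemma subgroupMl (gT : groupType) (H : set gT) h x :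
  subgroup H -> H h -> H (h * x)%g <-> H x.
Proof.
move=> gH Hh; split=> [Hhx|]; last exact: subgroupM.
by rewrite -(mulKg h x); apply: subgroupM => //; exact: subgroupV.
Qed.

Lemma subgroup_lcoset (gT : groupType) (H : set gT) h : subgroup H -> H h ->
  [set (h * x)%g | x in H] = H.
Proof.
move=> gH Hh; apply/seteqP; split=> [_ [x Hx <-]|x Hx]; first exact: subgroupM.
by exists (h^-1 * x)%g; rewrite ?mulVKg //; apply/subgroupMl => //; exact: subgroupV.
Qed.

Lemma generates_adj (gT : groupType) (S : set gT) : generates S ->
  forall x y, clos_refl_trans gT
    (fun a b => exists e : cayley_edges S, val e = [set a; b]) x y.
Proof.
move=> genS; set adj := fun a b => _.
have adjC a b : clos_refl_trans gT adj a b -> clos_refl_trans gT adj b a.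
  elim=> [c d [e ve]|c|c d f _ dc _ fd]; [|exact: rt_refl|exact: rt_trans fd dc].
  by apply: rt_step; exists e; rewrite setUC.
suff all g : forall x, clos_refl_trans gT adj x (x * g)%g.
  by move=> x y; rewrite -(mulVKg x y); exact: all.
have : [set: gT] g by [].
rewrite -genS; move: g; apply: smallest_sub.
  split; first by rewrite in_setE => x; rewrite mulg1; exact: rt_refl.
  move=> g h; rewrite !in_setE => gx hx x; rewrite mulgA.
  apply: rt_trans (gx x) _; apply: adjC.
  by rewrite -[X in clos_refl_trans _ _ _ X](mulgVK h); exact: hx.
move=> s Ss x; have [->|s1] := eqVneq s 1%g.
  by rewrite mulg1; exact: rt_refl.
apply: rt_step.
have eE : cayley_edges S [set x; (x * s)%g] by exists x, s.
by exists (SigSub (mem_set eE)).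
Qed.

(** * Paths of insertions, and mass transport *)

Section Propagate.
Context (gT : groupType) (S : set gT) (R : realType) (p : R).
Context (P : probability (config S) R).
Hypothesis p01 : 0 <= p <= 1.
Hypothesis p_gt0 : 0 < p.
Hypothesis bP : is_bernoulli_percolation p P.
Hypothesis genS : generates S.
Hypothesis cG : countable [set: gT].
Local Notation config := (config S).

(** If [Q] may be moved along an edge by opening this edge, then it can be moved
    along a finite path until its two arguments coincide. Each opening preserves
    null events, so [Q] is null when its diagonal is. *)
Lemma ae_propagate (bad : config -> Prop) (Q : config -> gT -> gT -> Prop) :
  {ae P, forall w, ~ bad w} ->
  (forall x, {ae P, forall w, ~ Q w x x}) ->
  (forall w (e : cayley_edges S) x x' y, val e = [set x; x'] -> ~ bad w ->
     Q w x y -> Q (ins e w) x' y) ->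
  {ae P, forall w, forall x y, ~ Q w x y}.
Proof.
move=> aebad Q0 QS; apply: ae_all => // x; apply: ae_all => // y.
elim: (clos_rt_rt1n _ _ _ _ (generates_adj genS x y)) => // a b c [e ve] _ IH.
apply: filterS2 aebad (ae_ins p01 bP e p_gt0 IH) => w nbad nQ Qac.
exact/nQ/(QS _ _ _ _ _ ve nbad).
Qed.

End Propagate.

Section MassTransport.
Context (gT : groupType) (S : set gT) (R : realType) (p : R).
Context (P : probability (config S) R).
Hypothesis bP : is_bernoulli_percolation p P.
Hypothesis cG : countable [set: gT].
Local Notation config := (config S).
Variables (H : set gT) (F : config -> gT -> gT -> Prop).
Hypothesis gH : subgroup H.
Hypothesis mF : forall x y, event (fun w => F w x y).
Hypothesis F_shift : forall h w x y, H h ->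
  F (shift h w) (h * x)%g (h * y)%g <-> F w x y.
Hypothesis F_fun : forall w x y y', H x -> H y -> H y' ->
  F w x y -> F w x y' -> y = y'.

Let idx_ex : exists idx : gT -> nat, injective idx.
Proof.
have /countable_injP[f finj] := cG; exists f => x y.
by apply: finj; rewrite inE.
Qed.

Let sent (idx : gT -> nat) n := [set w : config | exists y, [/\ H y, idx y = n & F w 1%g y]].
Let received (idx : gT -> nat) n :=
  [set w : config | exists y, [/\ H y, idx y = n & F w y^-1%g 1%g]].

Let m_sent (idx : gT -> nat) n : measurable (sent idx n).
Proof.
apply: event_ex => // y.
apply: (@event_ext _ _ (fun w => (H y /\ idx y = n) /\ F w 1%g y)) => [w|].
  by split=> [[[]]|[]].
by apply: event_and => //; exact: event_cst.
Qed.

Let m_received (idx : gT -> nat) n : measurable (received idx n).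
Proof.
apply: event_ex => // y.
apply: (@event_ext _ _ (fun w => (H y /\ idx y = n) /\ F w y^-1%g 1%g)) => [w|].
  by split=> [[[]]|[]].
by apply: event_and => //; exact: event_cst.
Qed.

(* The mass sent from the identity to [y] has the same law as the mass sent from
   the inverse of [y] to the identity. *)
Let prob_sent (idx : gT -> nat) n : injective idx ->
  P (sent idx n) = P (received idx n).
Proof.
move=> idx_inj.
have [[y [Hy yn]]|no] := pselect (exists y, H y /\ idx y = n); last first.
  by congr (P _); apply/seteqP; split=> w [y [Hy yn _]]; case: no; exists y.
rewrite (_ : sent idx n = [set w | F (shift y^-1%g w) y^-1%g 1%g]); last first.
  have E w : F (shift y^-1%g w) y^-1%g 1%g <-> F w 1%g y.
    by have := F_shift w 1%g y (subgroupV gH Hy); rewrite mulg1 mulVg.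
  apply/seteqP; split=> w /=; rewrite E; last by exists y.
  by case=> z [_ + ?]; rewrite -yn => /idx_inj <-.
rewrite (prob_shift bP _ (mF y^-1%g 1%g)); congr (P _).
apply/seteqP; split=> w /=; first by exists y.
by case=> z [_ + ?]; rewrite -yn => /idx_inj <-.
Qed.

Let sum_sent (idx : gT -> nat) : injective idx ->
  (\sum_(n <oo) P (received idx n) = P (\bigcup_n sent idx n))%E.
Proof.
move=> idx_inj; rewrite measure_semi_bigcup //; first last.
- exact: bigcupT_measurable.
- apply/trivIsetP => i j _ _ ij; apply/seteqP; split=> w //.
  case=> -[y [Hy yi Fy]] [z [Hz zj Fz]].
  by move/eqP: ij; apply; rewrite -yi -zj (F_fun (subgroup1 gH) Hy Hz Fy Fz).
by apply: eq_eseriesr => n _; exact/esym/prob_sent.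
Qed.

(** Each vertex of [H] sends at most one unit of mass, so by invariance the expected
    mass that a vertex receives is at most one, and what it receives is almost
    surely finite by the Borel-Cantelli lemma. *)
Lemma mass_transport_finite :
  {ae P, forall w, forall z, H z -> finite_set [set y | H y /\ F w y z]}.
Proof.
have [idx idx_inj] := idx_ex.
have at1 : {ae P, forall w, finite_set [set y | H y /\ F w y 1%g]}.
  have : P (lim_sup_set (received idx)) = 0%E.
    apply: lim_sup_set_cvg0 => //; rewrite sum_sent //.
    apply: le_lt_trans (probability_le1 _ _) (ltry _).
    exact: bigcupT_measurable.
  rewrite -[lim_sup_set _]/[set w | lim_sup_set (received idx) w] => /ae_prob0.
  have mlim : event (fun w => lim_sup_set (received idx) w).
    by apply: bigcapT_measurable => n; apply: bigcup_measurable.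
  move=> /(_ mlim); apply: filterS => w /existsNP[n /not_implyP[_ nrec]].
  apply: (@sub_finite_set _ _ ((fun y => idx y^-1%g) @^-1` `I_n)).
    move=> y [Hy Fy] /=; rewrite ltnNge; apply/negP => yn; apply: nrec.
    exists (idx y^-1%g) => //=; exists y^-1%g; rewrite invgK; split=> //.
    exact: subgroupV.
  apply: finite_preimage; last exact: finite_II.
  by move=> x y _ _ /= /idx_inj /invg_inj.
apply: ae_all => // z; have [Hz|nHz] := pselect (H z); last by apply/aeW => w /nHz.
apply: filterS (ae_shift bP z^-1%g at1) => w fin _.
apply: (@sub_finite_set _ _ [set (z * y)%g | y in
   [set y | H y /\ F (shift z^-1%g w) y 1%g]]); last exact: finite_image.
move=> y [Hy Fy]; exists (z^-1 * y)%g; last by rewrite mulVKg.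
have HVz := subgroupV gH Hz.
split; first exact: subgroupM.
by rewrite -(mulVg z); apply/F_shift.
Qed.

(** Exchanging each element of [H] with its inverse turns the disjoint events that
    the identity sends to a given element into the disjoint events that it receives
    from a given element. *)
Lemma mass_transport_inj :
  (forall w x x' y, H x -> H x' -> H y -> F w x y -> F w x' y -> x = x') ->
  P [set w | exists y, H y /\ F w 1%g y] = P [set w | exists y, H y /\ F w y 1%g].
Proof.
move=> F_inj; have [idx idx_inj] := idx_ex.
transitivity (P (\bigcup_n sent idx n)).
  congr (P _); apply/seteqP; split=> w /=.
    by move=> [y [Hy Fy]]; exists (idx y) => //; exists y.
  by move=> [n _ [y [Hy _ Fy]]]; exists y.
rewrite -sum_sent // -measure_semi_bigcup //; first last.
- exact: bigcupT_measurable.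
- apply/trivIsetP => i j _ _ ij; apply/seteqP; split=> w //.
  case=> -[y [Hy yi Fy]] [z [Hz zj Fz]]; move/eqP: ij; apply; rewrite -yi -zj.
  congr (idx _); apply: invg_inj.
  exact: F_inj (subgroupV gH Hy) (subgroupV gH Hz) (subgroup1 gH) Fy Fz.
congr (P _); apply/seteqP; split=> w /=.
  by move=> [n _ [y [Hy _ Fy]]]; exists y^-1%g; split=> //; exact: subgroupV.
move=> [y [Hy Fy]]; exists (idx y^-1%g) => //; exists y^-1%g.
by rewrite invgK; split=> //; exact: subgroupV.
Qed.

End MassTransport.

(** * Branches of the heavy cluster *)

Lemma finite_max (T : eqType) (r : T -> T -> Prop) (A : set T) :
  (forall x y z, r x y -> r y z -> r x z) ->
  (forall x y, A x -> A y -> r x y \/ r y x) ->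
  finite_set A -> A !=set0 -> exists2 x, A x & forall y, A y -> r y x.
Proof.
move=> r_trans + /finite_seqP[l Al]; rewrite {A}Al => r_total.
suff max a m : {subset a :: m <= l} ->
    exists2 x, x \in a :: m & forall y, y \in a :: m -> r y x.
  case: l max r_total => [|a m] max _ [x]; rewrite //= => _.
  exact: (max a m).
elim: m a => [|b m IH] a sub.
  exists a; rewrite ?mem_head // => y; rewrite inE => /eqP ->.
  by case: (r_total a a) => //=; apply: sub; exact: mem_head.
have subm y : y \in b :: m -> y \in l by move=> ym; apply: sub; rewrite in_cons ym orbT.
have [x xm xmax] := IH b subm.
have al : a \in l by apply: sub; exact: mem_head.
case: (r_total a x al (subm _ xm)) => [ax|xa].
  exists x; first by rewrite in_cons xm orbT.
  by move=> y; rewrite in_cons => /predU1P[->|/xmax].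
exists a; first exact: mem_head.
move=> y; rewrite in_cons => /predU1P[->|/xmax yx].
  by case: (r_total a a al al).
exact: r_trans yx xa.
Qed.

Section Branches.
Context (gT : groupType) (S : set gT).
Local Notation edge := (cayley_edges S).
Local Notation config := (config S).
Variables (H : set gT) (heavy : set (set gT)).
Hypothesis gH : subgroup H.
Hypothesis heavyS : forall K K' : set gT, K `<=` K' -> heavy K -> heavy K'.

(** Heaviness is kept abstract here; it is used through its monotonicity, its
    measurability and its invariance under [H]. *)
Definition light : set (set gT) := [set K | rel_infinite H K /\ ~ heavy K].

Variables (u0 v0 : gT) (e0 : edge).
Hypothesis ve0 : val e0 = [set u0; v0].
Implicit Types (w : config) (a b c h y : gT).
Local Notation E a := (edge_mul a e0).

(** The oriented edges in the [H]-orbit of [(u0, v0)] are coded by the elements of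
    [H]. The branch at [a] hangs at the first endpoint of the edge [a]. *)
Definition branch w a : set gT := cluster (del (E a) w) (a * u0)%g.

(** Cut edges between a light branch and a heavy remainder. *)
Definition good w a : Prop :=
  [/\ H a, w (E a), light (branch w a) &
      heavy (cluster (del (E a) w) (a * v0)%g)].

Lemma val_E a : val (E a) = [set (a * u0)%g; (a * v0)%g].
Proof. by rewrite val_edge_mul ve0 image_setU !image_set1. Qed.

Lemma branch_root w a : branch w a (a * u0)%g.
Proof. exact: conn_refl. Qed.

Lemma good_notin w a : good w a -> ~ branch w a (a * v0)%g.
Proof. by move=> [_ _ [_ nh] h] /cluster_eq ab; apply: nh; rewrite /branch ab. Qed.

Lemma good_edge_inj w a b : good w a -> good w b -> E a = E b -> a = b.
Proof.
move=> ga gb ab; have := congr1 val ab; rewrite !val_E => /ends_inj[[]|[u v]].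
  by move=> /mulIg.
have [_ _ [_ nh] _] := ga; have [_ _ _ h] := gb.
by case: nh; rewrite /branch u ab.
Qed.

Lemma branch_conn w a : branch w a `<=` cluster w (a * u0)%g.
Proof. exact: conn_delW. Qed.

Lemma del_other w e e' x y : w e -> e != e' -> val e = [set x; y] ->
  cluster (del e' w) x y.
Proof. by move=> we ee' ve; apply: open_conn ve; rewrite /del ee'. Qed.

Lemma del_sub w e e' x a b : val e' = [set a; b] ->
  ~ cluster (del e w) x a -> ~ cluster (del e w) x b ->
  cluster (del e w) x `<=` cluster (del e' w) x.
Proof.
move=> ve' xa xb; apply: conn_transfer => y f xy fy.
rewrite /del => /andP[_ ->]; rewrite andbT; apply/eqP => fe'.
by move: fy; rewrite fe' ve' => -[] /= yE; subst y.
Qed.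

(** If the second edge is outside the first branch, deleting that edge leaves the
    first branch connected. If it is inside, deleting it leaves connected the heavy
    part at the other end of the first edge, which can then not meet the second
    branch. *)
Lemma branch_laminar w a b y : good w a -> good w b ->
  branch w a y -> branch w b y ->
  branch w a `<=` branch w b \/ branch w b `<=` branch w a.
Proof.
move=> ga gb ay bY; have [<-|ab] := pselect (a = b); first by left.
have Eab : E a != E b by apply/eqP => /(good_edge_inj ga gb).
have [_ wa _ ha] := ga; have [_ wb [_ nhb] hb] := gb.
have buv : cluster (del (E a) w) (b * u0)%g (b * v0)%g.
  by apply: del_other (val_E b); rewrite // eq_sym.
have auv : cluster (del (E b) w) (a * u0)%g (a * v0)%g.
  exact: del_other (val_E a).
have [abu|nabu] := pselect (branch w a (b * u0)%g).
  right.
  have abv : branch w a (b * v0)%g := conn_trans abu buv.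
  have off z : branch w a z -> ~ cluster (del (E a) w) (a * v0)%g z.
    by move=> az vz; apply: (good_notin ga); apply: conn_trans az (conn_sym vz).
  have hav : heavy (cluster (del (E b) w) (a * v0)%g).
    apply: heavyS ha; apply: del_sub (val_E b) _ _; exact: off.
  have nbv : ~ branch w b (a * v0)%g.
    by move=> /cluster_eq bv; apply: nhb; rewrite /branch bv.
  have nbu : ~ branch w b (a * u0)%g.
    by move=> bu; apply: nbv; exact: conn_trans bu auv.
  have := del_sub (val_E a) nbu nbv; rewrite -(cluster_eq abu).
  by [].
left; have nabv : ~ branch w a (b * v0)%g.
  by move=> abv; apply: nabu; exact: conn_trans abv (conn_sym buv).
have sub := del_sub (val_E b) nabu nabv.
have bu : branch w b (a * u0)%g := conn_trans bY (conn_sym (sub _ ay)).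
by rewrite /branch (cluster_eq bu).
Qed.

(** The branch of [a] contains the first endpoint of the edge [a] and not the
    second, which only the deletion of [a] itself can separate. *)
Lemma branch_inj w a b : good w a -> good w b ->
  branch w a = branch w b -> a = b.
Proof.
move=> ga gb ab; apply: contrapT => nab.
have Eab : E a != E b by apply/eqP => /(good_edge_inj ga gb).
have [_ wa _ ha] := ga; have [_ wb [_ nhb] hb] := gb.
have auv : cluster (del (E b) w) (a * u0)%g (a * v0)%g.
  exact: del_other (val_E a).
apply: (good_notin ga); rewrite ab; apply: conn_trans auv.
by rewrite -/(branch w b) -ab; exact: branch_root.
Qed.

Lemma branch_anti w a b : good w a -> good w b ->
  branch w a `<=` branch w b -> branch w b `<=` branch w a -> a = b.
Proof. by move=> ga gb ab ba; apply: branch_inj ga gb _; apply/seteqP; split. Qed.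

(** The edges that separate [y] from [z] lie on every path between them. *)
Lemma finite_separating w y z : cluster w y z ->
  finite_set [set a | [/\ good w a, branch w a y & ~ branch w a z]].
Proof.
move=> /conn_finite_support[L LP].
apply: sub_finite_set (finite_edge_hits (e0 :: L)) => a [_ ay naz] /=.
exists e0; first exact: mem_head.
rewrite inE; apply/orP; right; apply: contrapT => /negP/LP yz.
by apply: naz; exact: conn_trans ay yz.
Qed.

Lemma good_uv w a : good w a -> cluster w (a * u0)%g (a * v0)%g.
Proof. by move=> [_ wa _ _]; exact: open_conn wa (val_E a). Qed.

(** An edge whose branch lies between those of [a] and [b] separates the root of the
    smaller branch from the far endpoint of [b]. *)
Lemma finite_between w a b : good w b ->
  finite_set [set c | [/\ good w c, branch w a `<=` branch w c &
                          branch w c `<=` branch w b]].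
Proof.
move=> gb; have [ab|nab] := pselect (branch w a `<=` branch w b); last first.
  rewrite (_ : [set c | _] = set0) //; apply/seteqP; split=> c //= -[_ ac cb].
  by apply: nab => y /ac/cb.
have yz : cluster w (a * u0)%g (b * v0)%g.
  apply: conn_trans (good_uv gb); apply: conn_sym; apply: branch_conn.
  by apply: ab; exact: branch_root.
apply: sub_finite_set (finite_separating yz) => c [gc ac cb]; split=> //.
  by apply: ac; exact: branch_root.
by move=> /cb; exact: good_notin.
Qed.

Lemma largest_branch w y (A : set gT) : finite_set A -> A !=set0 ->
  (forall a, A a -> good w a /\ branch w a y) ->
  exists2 a, A a & forall b, A b -> branch w b `<=` branch w a.
Proof.
move=> finA A0 Ay.
apply: (finite_max (r := fun a b => branch w a `<=` branch w b)) => //.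
- by move=> a b c ab bc t /ab/bc.
- by move=> a b /Ay[ga ay] /Ay[gb by_]; exact: branch_laminar ay by_.
Qed.

Definition child w b a : Prop :=
  [/\ good w b, good w a, b <> a, branch w b `<=` branch w a &
   forall c, good w c -> branch w b `<=` branch w c ->
     branch w c `<=` branch w a -> c = b \/ c = a].

Definition first w y a : Prop :=
  [/\ good w a, branch w a y &
   forall c, good w c -> branch w c y -> branch w a `<=` branch w c].

(** A maximal one among the finitely many branches strictly inside that of [a] that
    contain the branch of [b]. *)
Lemma child_above w a b : good w a -> good w b -> b <> a ->
  branch w b `<=` branch w a ->
  exists2 c, child w c a & branch w b `<=` branch w c.
Proof.
move=> ga gb nba ba.
pose A := [set c | [/\ good w c, branch w b `<=` branch w c &
                       branch w c `<=` branch w a]] `&` [set c | c <> a].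
have [c [[gc bc ca] nca] cmax] : exists2 c, A c & forall d, A d -> branch w d `<=` branch w c.
  apply: (@largest_branch _ (b * u0)%g).
  - exact: finite_setIl (finite_between b ga).
  - by exists b; split=> //; split.
  - by move=> c [[gc bc _] _]; split=> //; apply: bc; exact: branch_root.
exists c => //; split=> // d gd cd da; have [->|nda] := pselect (d = a); first by right.
left; apply: (branch_anti gd gc) => //; apply: cmax; split=> //; split=> // y /bc.
exact: cd.
Qed.

Lemma first_or_child w a y : good w a -> branch w a y ->
  first w y a \/ exists2 b, child w b a & branch w b y.
Proof.
move=> ga ay; have [|nf] := pselect (first w y a); [by left|right].
have [c [gc cy nac]] : exists c, [/\ good w c, branch w c y & ~ (branch w a `<=` branch w c)].
  apply: contrapT => no; apply: nf; split=> // c gc cy.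
  by apply: contrapT => nac; apply: no; exists c.
have ca : branch w c `<=` branch w a.
  by case: (branch_laminar ga gc ay cy).
have [|b ba cb] := child_above ga gc _ ca; last by exists b => //; exact: cb.
by move=> eq_ca; apply: nac; rewrite eq_ca.
Qed.

Lemma first_fun w y a b : first w y a -> first w y b -> a = b.
Proof.
move=> [ga ay amin] [gb bY bmin].
by apply: (branch_anti ga gb); [exact: amin|exact: bmin].
Qed.

Lemma parent_fun w a a' b : child w b a -> child w b a' -> a = a'.
Proof.
move=> [gb ga nba ba amin] [_ ga' nba' ba' amin'].
have := branch_laminar ga ga' (ba _ (branch_root w b)) (ba' _ (branch_root w b)).
case=> [aa'|a'a].
  by case: (amin' _ ga ba aa') => // eq_a; case: nba.
by case: (amin _ ga' ba' a'a) => // eq_a; case: nba'.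
Qed.

(** By [parent_fun] parents are unique, so the first two fields make every component
    of the forest of good edges a line that ascends forever. *)
Record line_like w : Prop := LineLike {
  has_parent : forall b, good w b -> exists a, child w b a;
  child_unique : forall a b b', child w b a -> child w b' a -> b = b';
  finite_first : forall a, good w a -> finite_set [set y | H y /\ first w y a]
}.

(** There are finitely many steps from [a] up to [b], and in each of them the only
    child of a branch is replaced by that branch, which adds the vertices whose
    first branch it is. *)
Lemma finite_above w a b : line_like w -> good w a -> good w b ->
  branch w a `<=` branch w b -> finite_set ((branch w b `\` branch w a) `&` H).
Proof.
move=> [par uniq fin] ga gb.
have /finite_seqP[l lE] := finite_between a gb.
have : [set c | [/\ good w c, branch w a `<=` branch w c &
                    branch w c `<=` branch w b]] `<=` [set` l] by rewrite lE.
have [n] := ubnP (size l); elim: n l a ga {lE} => // n IH l a ga.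
rewrite ltnS => ln sub ab; have [->|nab] := pselect (a = b).
  by rewrite setDv set0I.
have [a' ca] := par _ ga; have [_ ga' naa' aa' amin] := ca.
have a'b : branch w a' `<=` branch w b.
  have au := branch_root w a.
  case: (branch_laminar ga' gb (aa' _ au) (ab _ au)) => // ba'.
  by case: (amin _ gb ab ba') => E; subst b.
have al : a \in l by apply: sub; split.
apply: (@sub_finite_set _ _ ([set y | H y /\ first w y a'] `|`
    (branch w b `\` branch w a') `&` H)).
  move=> y [[bY nay] Hy]; have [a'y|na'y] := pselect (branch w a' y); last by right.
  left; split=> //; case: (first_or_child ga' a'y) => // -[d da' dy].
  by rewrite (uniq _ _ _ da' ca) in dy.
rewrite finite_setU; split; first exact: fin.
apply: (IH (rem a l)) => //.
  rewrite size_rem //; case: l al ln {sub} => // c l _ /=; exact.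
move=> c /= [gc a'c cb]; have cl : c \in l by apply: sub; split=> // y /aa'/a'c.
apply: contrapT => /negP nc.
have ca_ : c = a by apply/eqP; apply: contraNT nc => nca; rewrite rem_mem.
by subst c; exact/naa'/(branch_anti ga ga').
Qed.

(** Going up from [a] there is no last branch, while only finitely many branches
    separate the two roots. *)
Lemma common_above w a b : line_like w -> good w a -> good w b ->
  cluster w (a * u0)%g (b * u0)%g ->
  exists c, [/\ good w c, branch w a `<=` branch w c & branch w b `<=` branch w c].
Proof.
move=> [par _ _] ga gb uu.
have au := branch_root w a; have bu := branch_root w b.
have [[k [gk ak kb]]|no] := pselect (exists k, [/\ good w k,
    branch w a `<=` branch w k & branch w k (b * u0)%g]).
  case: (branch_laminar gk gb kb bu) => [kb'|bk]; last by exists k.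
  by exists b; split=> // y /ak/kb'.
pose A := [set k | [/\ good w k, branch w k (a * u0)%g & ~ branch w k (b * u0)%g]] `&`
  [set k | branch w a `<=` branch w k].
have Aup k : good w k -> branch w a `<=` branch w k -> A k.
  by move=> gk ak; split=> //; split=> //; [exact: ak|move=> kb; apply: no; exists k].
have [k [[gk _ _] ak] kmax] : exists2 c, A c & forall d, A d -> branch w d `<=` branch w c.
  apply: (@largest_branch _ (a * u0)%g).
  - exact: finite_setIl (finite_separating uu).
  - by exists a; exact: Aup.
  - by move=> k [[gk ak _] _].
have [k' [_ gk' nkk' kk' _]] := par _ gk; case: nkk'.
apply: (branch_anti gk gk') => //; apply: kmax; apply: Aup => // y /ak; exact: kk'.
Qed.

(** All but finitely many elements of [H] in a branch above both lie in each of the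
    two. *)
Lemma line_like_finite w a b : line_like w -> good w a -> good w b ->
  cluster w (a * u0)%g (b * u0)%g ->
  finite_set ((branch w b `\` branch w a) `&` H).
Proof.
move=> lw ga gb /(common_above lw ga gb)[c [gc ac bc]].
apply: sub_finite_set (finite_above lw ga gc ac) => y [[bY nay] Hy].
by split=> //; split=> //; exact: bc.
Qed.

Context (R : realType) (p : R) (P : probability config R).
Hypothesis bP : is_bernoulli_percolation p P.
Hypothesis cG : countable [set: gT].
Hypothesis heavy_shift : forall h (w : config) x, H h ->
  heavy (cluster (shift h w) (h * x)%g) <-> heavy (cluster w x).
Hypothesis m_heavy : forall x, event (fun w : config => heavy (cluster w x)).

Lemma light_shift h (w : config) x : H h ->
  light (cluster (shift h w) (h * x)%g) <-> light (cluster w x).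
Proof.
move=> Hh; have := rel_infinite_shift h w x H; rewrite (subgroup_lcoset gH Hh) => infE.
by rewrite /light /= infE heavy_shift.
Qed.

Lemma event_light x : event (fun w : config => light (cluster w x)).
Proof. by apply: event_and; [exact: event_rel_infinite|exact: event_not]. Qed.

Lemma del_shift h w a : del (E (h * a)%g) (shift h w) = shift h (del (E a) w).
Proof. by rewrite shift_del edge_mulM. Qed.

Lemma branch_shift h w a y :
  branch (shift h w) (h * a)%g (h * y)%g <-> branch w a y.
Proof. by rewrite /branch del_shift -mulgA conn_shift. Qed.

Lemma good_shift h w a : H h -> good (shift h w) (h * a)%g <-> good w a.
Proof.
move=> Hh.
have wE : shift h w (E (h * a)%g) = w (E a) by rewrite /shift -edge_mulM edge_mulK.
have lE : light (branch (shift h w) (h * a)%g) <-> light (branch w a).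
  by rewrite /branch del_shift -mulgA light_shift.
have hE : heavy (cluster (del (E (h * a)%g) (shift h w)) (h * a * v0)%g) <->
    heavy (cluster (del (E a) w) (a * v0)%g).
  by rewrite del_shift -mulgA heavy_shift.
split=> -[Ha wa la ha]; split.
- exact/(subgroupMl _ gH Hh).
- by rewrite -wE.
- exact/lE.
- exact/hE.
- exact/(subgroupMl _ gH Hh).
- by rewrite wE.
- exact/lE.
- exact/hE.
Qed.

Lemma branch_sub_shift h w a b :
  branch (shift h w) (h * a)%g `<=` branch (shift h w) (h * b)%g <->
  branch w a `<=` branch w b.
Proof.
split=> ab y; first by move=> /(branch_shift h)/ab/branch_shift.
by rewrite -(mulVKg h y) => /branch_shift/ab/branch_shift.
Qed.

Lemma child_shift h w a b : H h ->
  child (shift h w) (h * b)%g (h * a)%g <-> child w b a.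
Proof.
suff imp h' w' a' b' : H h' -> child w' b' a' -> child (shift h' w') (h' * b')%g (h' * a')%g.
  move=> Hh; split; last exact: imp.
  by move/(imp _ _ _ _ (subgroupV gH Hh)); rewrite shiftK !mulKg.
move=> Hh [gb ga nba ba amin]; split.
- exact/(good_shift _ _ Hh).
- exact/(good_shift _ _ Hh).
- by move=> /mulgI.
- exact/branch_sub_shift.
- move=> c; rewrite -(mulVKg h' c) => /(good_shift _ _ Hh) gc /branch_sub_shift bc.
  by move=> /branch_sub_shift ca; case: (amin _ gc bc ca) => ->; [left|right].
Qed.

Lemma first_shift h w y a : H h ->
  first (shift h w) (h * y)%g (h * a)%g <-> first w y a.
Proof.
suff imp h' w' y' a' : H h' -> first w' y' a' -> first (shift h' w') (h' * y')%g (h' * a')%g.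
  move=> Hh; split; last exact: imp.
  by move/(imp _ _ _ _ (subgroupV gH Hh)); rewrite shiftK !mulKg.
move=> Hh [ga ay amin]; split; first exact/(good_shift _ _ Hh).
  exact/branch_shift.
move=> c; rewrite -(mulVKg h' c) => /(good_shift _ _ Hh) gc /branch_shift cy.
exact/branch_sub_shift/amin.
Qed.

Lemma event_branch a y : event (fun w => branch w a y).
Proof.
exact: (event_comp (measurable_del (E a)) (event_conn cG (a * u0)%g y)).
Qed.

Lemma event_good a : event (fun w => good w a).
Proof.
apply: (@event_ext _ _ (fun w => (H a /\ w (E a)) /\
  (light (branch w a) /\ heavy (cluster (del (E a) w) (a * v0)%g)))).
  by move=> w; split=> [[[? ?] [? ?]]|[? ? ? ?]].
apply: event_and; first by apply: event_and; [exact: event_cst|exact: event_open].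
apply: event_and.
  exact: (event_comp (measurable_del (E a)) (event_light (a * u0)%g)).
exact: (event_comp (measurable_del (E a)) (m_heavy (a * v0)%g)).
Qed.

Lemma event_branch_sub a b : event (fun w => branch w a `<=` branch w b).
Proof.
by apply: event_all => // y; apply: event_imp; exact: event_branch.
Qed.

Lemma event_child b a : event (fun w => child w b a).
Proof.
apply: (@event_ext _ _ (fun w => (good w b /\ good w a) /\
  (b <> a /\ (branch w b `<=` branch w a /\
   forall c, good w c -> branch w b `<=` branch w c ->
     branch w c `<=` branch w a -> c = b \/ c = a)))).
  by move=> w; split=> [[[? ?] [? [? ?]]]|[? ? ? ? ?]].
apply: event_and; first by apply: event_and; exact: event_good.
apply: event_and; first exact: event_cst.
apply: event_and; first exact: event_branch_sub.
apply: event_all => // c; apply: event_imp; first exact: event_good.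
apply: event_imp; first exact: event_branch_sub.
apply: event_imp; first exact: event_branch_sub.
exact: event_cst.
Qed.

Lemma event_first y a : event (fun w => first w y a).
Proof.
apply: (@event_ext _ _ (fun w => good w a /\ (branch w a y /\
   forall c, good w c -> branch w c y -> branch w a `<=` branch w c))).
  by move=> w; split=> [[? [? ?]]|[? ? ?]].
apply: event_and; first exact: event_good.
apply: event_and; first exact: event_branch.
apply: event_all => // c; apply: event_imp; first exact: event_good.
apply: event_imp; first exact: event_branch.
exact: event_branch_sub.
Qed.

(** Each vertex of [H] sends its mass to the first branch that contains it. *)
Lemma ae_finite_first :
  {ae P, forall w, forall a, good w a -> finite_set [set y | H y /\ first w y a]}.
Proof.
have := mass_transport_finite bP cG gH event_first.
move=> /(_ (fun h w y a => @first_shift h w y a)) aefin.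
have := aefin (fun w y a b _ _ _ => @first_fun w y a b).
by apply: filterS => w fin a [Ha _ _ _]; exact: fin.
Qed.

(** A vertex of the branch outside all its sub-branches has the branch as its first
    one, so the infinitely many vertices of the branch cannot all be such. *)
Lemma has_child w a : good w a -> finite_set [set y | H y /\ first w y a] ->
  exists b, child w b a.
Proof.
move=> ga fin; apply: contrapT => no.
have [_ _ [inf _] _] := ga; apply: inf; apply: sub_finite_set fin => y [ay Hy].
split=> //; case: (first_or_child  ga ay) => // -[b ba _].
by case: no; exists b.
Qed.

Section Preferred.
Variable idx : gT -> nat.
Hypothesis idx_inj : injective idx.

(** The invariant choice of one child: its position relative to the parent has
    the least index. *)
Definition preferred w a b : Prop := child w b a /\
  forall c, child w c a -> (idx (a^-1 * b)%g <= idx (a^-1 * c)%g)%N.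

Lemma preferred_shift h w a b : H h ->
  preferred (shift h w) (h * a)%g (h * b)%g <-> preferred w a b.
Proof.
move=> Hh; rewrite /preferred child_shift // invgM -mulgA mulKg.
split=> -[ba bmin]; split=> // c.
  by move=> /(child_shift _ _ _ Hh)/bmin; rewrite -mulgA mulKg.
by rewrite -(mulVKg h c) => /(child_shift _ _ _ Hh)/bmin; rewrite -mulgA !mulKg.
Qed.

Lemma event_preferred a b : event (fun w => preferred w a b).
Proof.
apply: event_and; first exact: event_child.
apply: event_all => // c; apply: event_imp; first exact: event_child.
exact: event_cst.
Qed.

Lemma preferred_fun w a b b' : preferred w a b -> preferred w a b' -> b = b'.
Proof.
move=> [ba bmin] [ba' bmin']; apply: (mulgI a^-1%g); apply: idx_inj.
by apply/eqP; rewrite eqn_leq bmin // bmin'.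
Qed.

Lemma preferred_ex w a b : child w b a -> exists b', preferred w a b'.
Proof.
move=> ba; pose Q n := `[< exists c, child w c a /\ idx (a^-1 * c)%g = n >].
have exQ : exists n, Q n by exists (idx (a^-1 * b)%g); apply/asboolP; exists b.
have [n /asboolP[c [ca <-]] nmin] := ex_minnP exQ.
exists c; split=> // d da; apply: nmin; apply/asboolP; by exists d.
Qed.

(** Each good edge sends its mass to its preferred child, which exists, and each
    child has only one parent. So the good edges and the preferred children have
    the same density, and a.s. every good edge is a preferred child. *)
Lemma ae_parent : {ae P, forall w, forall b, good w b ->
  exists2 a, H a & preferred w a b}.
Proof.
have fun_ w a b b' : H a -> H b -> H b' -> preferred w a b -> preferred w a b' -> b = b'.
  by move=> _ _ _; exact: preferred_fun.
have inj w a a' b : H a -> H a' -> H b -> preferred w a b -> preferred w a' b -> a = a'.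
  move=> _ _ _ [ba _] [ba' _].
  exact: (parent_fun  ba ba').
have balance := mass_transport_inj bP cG gH event_preferred
  (fun h w a b => @preferred_shift h w a b) fun_ inj.
have m1 : event (fun w => exists y, H y /\ preferred w 1%g y).
  by apply: event_ex => // y; apply: event_and;
    [exact: event_cst|exact: event_preferred].
have m2 : event (fun w => exists y, H y /\ preferred w y 1%g).
  by apply: event_ex => // y; apply: event_and;
    [exact: event_cst|exact: event_preferred].
have E1 : P [set w | exists y, H y /\ preferred w 1%g y] = P [set w | good w 1%g].
  apply: prob_eq_ae => //; first exact: event_good.
  apply: filterS ae_finite_first => w fin; split=> [[y [_ [[]]]]//|g1].
  have [b /preferred_ex[b' b'1]] := has_child g1 (fin _ g1).
  by exists b'; split=> //; have [[[]]] := b'1.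
have at1 : {ae P, forall w, good w 1%g -> exists y, H y /\ preferred w y 1%g}.
  have mbad : event (fun w => good w 1%g /\ ~ exists y, H y /\ preferred w y 1%g).
    by apply: event_and; [exact: event_good|exact: event_not].
  have /(ae_prob0 P mbad) : P [set w | good w 1%g /\
      ~ exists y, H y /\ preferred w y 1%g] = 0%E.
    set X := [set w | exists y, H y /\ preferred w y 1%g] in balance.
    have lt_oo : (P [set w | good w 1%g] < +oo)%E.
      exact: le_lt_trans (probability_le1 _ (event_good 1%g)) (ltry _).
    apply: (eq_trans (measureD (event_good 1%g) m2 lt_oo)).
    have -> : [set w | good w 1%g] `&` X = X.
      by rewrite setIC setIidl // => w [y [_ [[]]]].
    apply: (eq_trans (congr1 (fun t => t - P X)%E (etrans (esym E1) balance))).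
    by apply: subee; rewrite fin_num_measure.
  by apply: filterS => w nbad g1; apply: contrapT => no; apply: nbad.
apply: ae_all => // b; have [Hb|nHb] := pselect (H b); last by apply/aeW => w [/nHb].
apply: filterS (ae_shift bP b^-1%g at1) => w pw gb.
have HVb := subgroupV gH Hb.
have [y [Hy pby]] : exists y, H y /\ preferred (shift b^-1%g w) y 1%g.
  by apply: pw; rewrite -(mulVg b); apply/good_shift.
exists (b * y)%g; first exact: subgroupM.
apply/(preferred_shift _ _ _ HVb); rewrite mulKg mulVg.
exact: pby.
Qed.

End Preferred.

Lemma ae_line_like : {ae P, forall w, line_like w}.
Proof.
have /countable_injP[idx finj] := cG.
have idx_inj : injective idx by move=> x y; apply: finj; rewrite inE.
apply: filterS2 ae_finite_first (ae_parent idx_inj) => w fin par.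
split=> // [b /par[a _ [ba _]]|a b b' ba b'a]; first by exists a.
have pref c : child w c a -> preferred idx w a c.
  move=> ca; have [gc _ _ _ _] := ca.
  have [a' _ pca] := par c gc; have [ca' _] := pca.
  by rewrite (parent_fun  ca ca').
exact: (preferred_fun idx_inj (pref _ ba) (pref _ b'a)).
Qed.

End Branches.

(** * Uniqueness for a subgroup and for a supergroup *)

Lemma infinite_sequence (T : choiceType) (A : set T) : infinite_set A ->
  exists2 a : nat -> T, forall n, A (a n) & injective a.
Proof.
move=> /infiniteP/card_leP[f].
exists (fun n => val (f (SigSub (mem_set (I : [set: nat] n))))) => [n|n m].
  exact/set_mem/valP.
by move=> /val_inj /(inj (f := f)); rewrite !inE => /(_ I I) /(congr1 val).
Qed.

Section Uniqueness.
Context (gT : groupType) (S : set gT) (R : realType) (p : R).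
Context (P : probability (config S) R).
Hypothesis p01 : 0 <= p <= 1.
Hypothesis bP : is_bernoulli_percolation p P.
Hypothesis genS : generates S.
Hypothesis cG : countable [set: gT].
Local Notation edge := (cayley_edges S).
Local Notation config := (config S).
Implicit Types (w : config) (x y h s : gT) (A K : set gT).

Lemma ae_unique_coset A s : {ae P, forall w, unique_infinite A w} ->
  {ae P, forall w, unique_infinite [set (s * h)%g | h in A] w}.
Proof.
move=> /(ae_shift bP s^-1%g); apply: filterS => w [[x infx] uniq]; split.
  exists (s * x)%g; rewrite -[w](shiftVK s).
  exact/rel_infinite_shift.
move=> x' y'; rewrite -(mulVKg s x') -(mulVKg s y') -[w](shiftVK s).
by move=> /rel_infinite_shift infx' /rel_infinite_shift infy'; apply/conn_shift/uniq.
Qed.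

Lemma ae_closed : p = 0 -> {ae P, forall w, forall x y, ~ open_adj w x y}.
Proof.
move=> p0; apply: ae_all => // x; apply: ae_all => // y.
have [[e ve]|no] := pselect (exists e : edge, val e = [set x; y]); last first.
  by apply/aeW => w [e _ ve]; apply: no; exists e.
have Pe0 : P [set w : config | w e] = 0%E.
  rewrite (resample p01 bP e (event_open e)) p0 mul0e add0e.
  rewrite (_ : [set w | _] = set0) ?measure0 ?mule0 //.
  by apply/seteqP; split=> w //=; rewrite /del eqxx.
have /(ae_prob0 P (event_open e)) : P [set w : config | w e] = 0%E := Pe0.
apply: filterS => w nwe [e' we' ve']; apply: nwe.
by rewrite (val_inj (etrans ve (esym ve'))).
Qed.

(** At [p = 0] all clusters are singletons. *)
Lemma unique_infinite_p_gt0 A : {ae P, forall w, unique_infinite A w} -> 0 < p.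
Proof.
move=> aeu; have /andP[p_ge0 _] := p01; rewrite lt_neqAle p_ge0 andbT eq_sym.
apply/eqP => /ae_closed aecl.
have [w [[[x infx] _] cl]] := ae_sat (filterI aeu aecl).
apply: infx; apply: sub_finite_set (finite_set1 x) => y [xy _] /=.
by elim/conn_ind: xy => [//|a b _ _ /cl].
Qed.

Section Subgroups.
Variables H1 H2 : set gT.
Hypotheses (gH1 : subgroup H1) (gH2 : subgroup H2) (H12 : H1 `<=` H2).

(** The probability that a point of [H1] lies in an [H2]-infinite cluster does not
    depend on the point, and it bounds from below the probability that infinitely
    many of the points of a sequence in [H1] do. By uniqueness these all lie in one
    cluster, which is then [H1]-infinite. *)
Lemma ae_unique_subgroup : infinite_set H1 ->
  {ae P, forall w, unique_infinite H2 w} -> {ae P, forall w, unique_infinite H1 w}.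
Proof.
move=> infH1 aeu; pose Q w := exists x, rel_infinite H1 (cluster w x).
have mQ : event Q by apply: event_ex => // x; exact: event_rel_infinite.
suff P1 : P [set w | Q w] = 1%E.
  apply: filterS2 (ae_prob1 mQ P1) aeu => w Qw [_ uniq]; split=> // x y infx infy.
  by apply: uniq; apply: rel_infiniteS (_ : rel_infinite H1 _) => // ? _; exact: H12.
have invQ h w : H1 h -> Q (shift h w) <-> Q w.
  suff imp h' w' : H1 h' -> Q w' -> Q (shift h' w').
    by move=> Hh; split; [move=> /(imp _ _ (subgroupV gH1 Hh)); rewrite shiftK|exact: imp].
  move=> Hh [x infx]; exists (h' * x)%g.
  by rewrite -(subgroup_lcoset gH1 Hh); apply/rel_infinite_shift.
have [P0|//] := zero_one p01 bP infH1 mQ invQ; exfalso.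
have /(ae_prob0 P mQ) aenQ := P0.
have [a aH a_inj] : exists2 a : nat -> gT, forall n, H1 (a n) & injective a := infinite_sequence infH1.
pose F n := [set w : config | rel_infinite H2 (cluster w (a n))].
have mF n : measurable (F n) by exact: event_rel_infinite.
have PF h : H2 h -> P [set w | rel_infinite H2 (cluster w h)] =
    P [set w | rel_infinite H2 (cluster w 1%g)].
  move=> Hh; rewrite -(prob_shift bP h (event_rel_infinite (S := S) cG H2 h)).
  have hE w : rel_infinite H2 (cluster (shift h w) h) <-> rel_infinite H2 (cluster w 1%g).
    by have := rel_infinite_shift h w 1%g H2; rewrite (subgroup_lcoset gH2 Hh) mulg1.
  by congr (P _); apply/seteqP; split=> w /hE.
have le_limsup : (P [set w | rel_infinite H2 (cluster w 1%g)] <= P (lim_sup_set F))%E.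
  have cvgF := lim_sup_set_cvg P F mF (le_lt_trans (probability_le1 P
    (bigcup_measurable (fun k _ => mF k))) (ltry _)).
  rewrite -(cvg_lim _ cvgF) //; apply: lime_ge; first by apply/cvg_ex; eexists; exact: cvgF.
  apply: nearW => n; rewrite -(PF (a n) (H12 (aH n))).
  have mU : measurable (\bigcup_(k >= n) F k) by exact: bigcup_measurable.
  apply: le_measure; [by apply/mem_set; exact: mF|exact/mem_set|].
  by move=> w Fw; exists n => /=.
have mlim : event (fun w => lim_sup_set F w).
  by apply: bigcapT_measurable => n; apply: bigcup_measurable.
have aelim : {ae P, forall w, ~ lim_sup_set F w}.
  apply: filterS2 aenQ aeu => w nQ [_ uniq] limF; apply: nQ.
  have [n0 _ Fn0] := limF 0%N I; exists (a n0) => fin.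
  have /finite_seqP[l lE] : finite_set (a @^-1` (cluster w (a n0) `&` H1)).
    by apply: finite_preimage => // x y _ _; exact: a_inj.
  have [k /= lk Fk] := limF (\max_(i <- l) i).+1 I.
  have kl : k \in l.
    have : [set` l] k by rewrite -lE; split; [exact: uniq|exact: aH].
    by [].
  by move: lk; rewrite ltnNge; apply/negP/negPn; exact: leq_bigmax_seq.
have c0 : P [set w | rel_infinite H2 (cluster w 1%g)] = 0%E.
  apply/eqP; rewrite eq_le measure_ge0 andbT; apply: le_trans le_limsup _.
  by move: aelim => /(ae_prob0 P mlim) ->.
have : {ae P, forall w, forall h, H2 h -> ~ rel_infinite H2 (cluster w h)}.
  apply: ae_all => // h; have [Hh|nHh] := pselect (H2 h); last by apply/aeW => w /nHh.
  have /(ae_prob0 P (event_rel_infinite (S := S) cG H2 h)) : 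
    P [set w | rel_infinite H2 (cluster w h)] = 0%E by rewrite PF.
  by apply: filterS => w.
move=> /(filterI aeu)/ae_sat[w [[[x infx] _] no]].
have [y [xy Hy] _] := (infinite_setP_seq _).1 infx [::].
by apply: (no y Hy); rewrite -(cluster_eq xy).
Qed.

Hypothesis sH12 : s_normal H1 H2.
Local Notation coset s := [set (s * h)%g | h in H1].

Lemma s_normal_infinite : infinite_set H1.
Proof.
have := sH12 (subgroup1 gH2); rewrite (subgroup_lcoset gH1 (subgroup1 gH1)).
by move=> inf fin; apply: inf; apply: finite_setIl.
Qed.

Hypothesis uniqueH1 : {ae P, forall w, unique_infinite H1 w}.

Let p_gt0 : 0 < p := unique_infinite_p_gt0 uniqueH1.

(** The group of the common translations of [H1] and its coset is infinite, so
    whether one cluster meets both infinitely often is decided almost surely;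
    opening a finite path rules out that no cluster does. *)
Lemma ae_same_cluster s : H2 s -> {ae P, forall w, exists x,
  rel_infinite H1 (cluster w x) /\ rel_infinite (coset s) (cluster w x)}.
Proof.
move=> Hs; pose M w := exists x,
  rel_infinite H1 (cluster w x) /\ rel_infinite (coset s) (cluster w x).
have mM : event M.
  by apply: event_ex => // x; apply: event_and; exact: event_rel_infinite.
pose I := [set a | H1 a /\ exists2 h, H1 h & (a * s)%g = (s * h)%g].
have infI : infinite_set I.
  move=> finI; apply: (sH12 Hs).
  apply: sub_finite_set (finite_image (fun a => a * s)%g finI).
  move=> _ [[h Hh <-] [a Ha as_]]; exists a => //; split=> //.
  by exists h.
have invM a w : I a -> M (shift a w) <-> M w.
  suff imp a' w' : I a' -> M w' -> M (shift a' w').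
    move=> Ia; split; last exact: imp.
    have IV : I a^-1%g.
      have [Ha [h Hh as_]] := Ia; split; first exact: subgroupV.
      exists h^-1%g; first exact: subgroupV.
      by apply: (mulgI a); rewrite !mulgA mulgV mul1g as_ mulgK.
    by move=> /(imp _ _ IV); rewrite shiftK.
  move=> [Ha [h Hh as_]] [x [inf1 infs]]; exists (a' * x)%g; split.
    by rewrite -(subgroup_lcoset gH1 Ha); apply/rel_infinite_shift.
  suff <- : [set (a' * y)%g | y in coset s] = coset s by apply/rel_infinite_shift.
  rewrite -[in RHS](subgroup_lcoset gH1 Hh) !image_comp.
  by apply: eq_imagel => y _ /=; rewrite !mulgA as_.
have [P0|P1] := zero_one p01 bP infI mM invM; last exact: ae_prob1.
have /(ae_prob0 P mM) aenM := P0.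
have aeno : {ae P, forall w, forall x y,
    ~ (rel_infinite H1 (cluster w x) /\ rel_infinite (coset s) (cluster w y))}.
  apply: (ae_propagate (bad := fun=> False) p01 p_gt0 bP genS cG).
  - by apply/aeW => w [].
  - by move=> x; apply: filterS aenM => w nM xx; apply: nM; exists x.
  - move=> w e x x' y ve _ [inf1 infs]; split.
      by apply: rel_infinite_sub inf1; rewrite -(cluster_eq (conn_ins_edge w ve)); exact: conn_insW.
    by apply: rel_infinite_sub infs; exact: conn_insW.
have [w [[no [[x infx] _]] [[y infy] _]]] :=
  ae_sat (filterI (filterI aeno uniqueH1) (ae_unique_coset s uniqueH1)).
by case: (no x y).
Qed.

(** Unlike the property of having infinite intersection with [H1], this one is
    invariant under the translations by [H2]. *)
Definition heavy : set (set gT) :=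
  [set K | exists2 s, H2 s & rel_infinite (coset s) K].

Lemma heavyS K K' : K `<=` K' -> heavy K -> heavy K'.
Proof. by move=> KK' [s Hs inf]; exists s => //; exact: rel_infinite_sub inf. Qed.

Lemma heavyU K K' : heavy (K `|` K') -> heavy K \/ heavy K'.
Proof.
move=> [s Hs inf]; apply: contrapT => /not_orP[nK nK']; apply: inf.
rewrite setIUl finite_setU; split; apply: contrapT => inf.
  by apply: nK; exists s.
by apply: nK'; exists s.
Qed.

Lemma heavy_rel_infinite K : heavy K -> rel_infinite H2 K.
Proof.
move=> [s Hs inf] fin; apply: inf; apply: sub_finite_set fin.
move=> _ [/[swap] -[h Hh <-] Kh]; split=> //; apply: subgroupM => //; exact: H12.
Qed.

Lemma heavy_shift h w x : H2 h ->
  heavy (cluster (shift h w) (h * x)%g) <-> heavy (cluster w x).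
Proof.
suff imp h' w' x' : H2 h' -> heavy (cluster w' x') ->
    heavy (cluster (shift h' w') (h' * x')%g).
  move=> Hh; split; last exact: imp.
  by move/(imp _ _ _ (subgroupV gH2 Hh)); rewrite shiftK mulKg.
move=> Hh [s Hs inf]; exists (h' * s)%g; first exact: subgroupM.
suff -> : coset (h' * s)%g = [set (h' * y)%g | y in coset s].
  exact/rel_infinite_shift.
by rewrite image_comp; apply: eq_imagel => y _ /=; rewrite mulgA.
Qed.

Lemma event_heavy x : event (fun w => heavy (cluster w x)).
Proof.
apply: (@event_ext _ _ (fun w => exists s, H2 s /\ rel_infinite (coset s) (cluster w x))).
  by move=> w; split=> [[s []]|[s]]; exists s.
apply: event_ex => // s; apply: event_and; first exact: event_cst.
exact: event_rel_infinite.
Qed.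

(** The cluster with infinite intersection with a coset is a.s. the one with infinite
    intersection with [H1]. *)
Lemma ae_unique_heavy : {ae P, forall w, (exists x, heavy (cluster w x)) /\
  forall x y, heavy (cluster w x) -> heavy (cluster w y) -> cluster w x y}.
Proof.
have aesame : {ae P, forall w, forall s, H2 s -> exists x,
    rel_infinite H1 (cluster w x) /\ rel_infinite (coset s) (cluster w x)}.
  apply: ae_all => // s; have [Hs|nHs] := pselect (H2 s); last by apply/aeW => w /nHs.
  by apply: filterS (ae_same_cluster Hs).
have aecoset : {ae P, forall w, forall s, unique_infinite (coset s) w}.
  by apply: ae_all => // s; exact: ae_unique_coset.
apply: filterS2 (filterI aesame aecoset) uniqueH1 => w [same ucoset] [_ uniq].
split.
  have [x [_ inf]] := same 1%g (subgroup1 gH2).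
  by exists x, 1%g => //; exact: subgroup1.
have main x : heavy (cluster w x) -> exists2 z, rel_infinite H1 (cluster w z) & cluster w x z.
  move=> [s Hs infx]; have [z [inf1 infs]] := same s Hs.
  by exists z => //; apply: (ucoset s).2.
move=> x y /main[z inf1 xz] /main[t inf2 yt].
exact: conn_trans xz (conn_trans (uniq _ _ inf1 inf2) (conn_sym yt)).
Qed.

Local Notation light := (light H2 heavy).

(** Opening one edge from a light to a heavy cluster, then a second one, creates
    two branches one of which exceeds the other by infinitely many elements
    of [H2]. *)
Lemma two_branches u0 v0 (e0 : edge) w h k (ve0 : val e0 = [set u0; v0]) :
  let E a := edge_mul a e0 in
  let w1 := ins (E h) w in let w2 := ins (E k) w1 in
  H2 h -> light (cluster w (h * u0)%g) -> heavy (cluster w (h * v0)%g) ->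
  H2 k -> light (cluster w1 (k * u0)%g) -> heavy (cluster w1 (k * v0)%g) ->
  (forall x y, heavy (cluster w2 x) -> heavy (cluster w2 y) -> cluster w2 x y) ->
  ~ line_like H2 heavy u0 v0 e0 w2.
Proof.
move=> E w1 w2 Hh lu hv Hk lu1 hv1 uniq lw.
have vE a : val (E a) = [set (a * u0)%g; (a * v0)%g] := val_E ve0 a.
have closed (w' : config) a : light (cluster w' (a * u0)%g) ->
    heavy (cluster w' (a * v0)%g) -> ~~ w' (E a).
  move=> [_ nh] hv'; apply/negP => wE; apply: nh.
  by rewrite (cluster_eq (open_conn wE (vE a))).
have ncl_h := closed _ _ lu hv; have ncl_k := closed _ _ lu1 hv1.
have hk : E h != E k.
  by apply: contraNneq ncl_k => <-; rewrite /w1 /ins eqxx.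
have w1uv : cluster w1 (h * u0)%g (h * v0)%g := conn_ins_edge w (vE h).
have heavy1 : heavy (cluster w1 (h * u0)%g).
  by rewrite (cluster_eq w1uv); apply: heavyS hv; exact: conn_insW.
have off1 y : cluster w1 (k * u0)%g y -> ~ cluster w1 (h * u0)%g y.
  move=> ky hy; have [_] := lu1; apply.
  by rewrite (cluster_eq (conn_trans ky (conn_sym hy))).
have gk : good H2 heavy u0 v0 e0 w2 k.
  by split; rewrite /branch /w2 -/(E k) ?del_ins_closed //; rewrite /ins eqxx.
have delh : del (E h) w2 = ins (E k) w by exact: del_ins_neq.
have gh : good H2 heavy u0 v0 e0 w2 h.
  split=> //.
  - by rewrite /w2 /w1 /ins eqxx orbT.
  - rewrite /branch -/(E h) delh; split.
      by apply: rel_infinite_sub lu.1; exact: conn_insW.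
    have nku : ~ cluster w (h * u0)%g (k * u0)%g.
      move=> /(conn_insW (E h)); apply: off1; exact: conn_refl.
    have [_ nhu] := lu.
    have [kv|nkv] := pselect (cluster w (h * u0)%g (k * v0)%g); last first.
      by rewrite (conn_ins_off (vE k) nku nkv).
    move=> /(heavyS (conn_ins_sub (vE k))) /heavyU[//|/heavyU[hku|]].
      have [_] := lu1; apply; apply: heavyS hku; exact: conn_insW.
    by rewrite -(cluster_eq kv).
  - by rewrite -/(E h) delh; apply: heavyS hv; exact: conn_insW.
have conn2 : cluster w2 (k * u0)%g (h * u0)%g.
  have w2k : cluster w2 (k * u0)%g (k * v0)%g := conn_ins_edge w1 (vE k).
  apply: conn_trans w2k _; apply: uniq.
    by apply: heavyS hv1; exact: conn_insW.
  by apply: heavyS heavy1; exact: conn_insW.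
have [inf _] := lu; apply: inf.
apply: sub_finite_set (line_like_finite heavyS ve0 lw gk gh conn2).
move=> y [hy Hy]; split=> //; split.
  by rewrite /branch -/(E h) delh; exact: conn_insW.
rewrite /branch -/(E k) /w2 del_ins_closed // => ky.
exact: (off1 _ ky (conn_insW _ hy)).
Qed.

(** If no edge ever joins a light cluster to a heavy one, opening the edges of a path
    from one to the other moves the light cluster along this path until it meets
    the heavy one. Otherwise some edge does, and the almost sure existence of such
    an edge in its orbit holds in particular after its opening, which
    [two_branches] turns into a contradiction with [ae_line_like]. *)
Lemma ae_no_light : {ae P, forall w, forall x, ~ light (cluster w x)}.
Proof.
have m_light := event_light H2 cG event_heavy.
have [noadj|] := pselect (forall u v (e : edge), val e = [set u; v] ->
    {ae P, forall w, ~ (light (cluster w u) /\ heavy (cluster w v))}).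
  have aebad : {ae P, forall w, ~ exists u, exists v, (exists e : edge, val e = [set u; v]) /\
      (light (cluster w u) /\ heavy (cluster w v))}.
    have : {ae P, forall w, forall u v, (exists e : edge, val e = [set u; v]) ->
        ~ (light (cluster w u) /\ heavy (cluster w v))}.
      apply: ae_all => // u; apply: ae_all => // v.
      have [[e ve]|no] := pselect (exists e : edge, val e = [set u; v]); last first.
        by apply/aeW => w /no.
      by apply: filterS (noadj _ _ _ ve).
    by apply: filterS => w no [u [v [ex lh]]]; exact: (no u v).
  have : {ae P, forall w, forall x y, ~ (light (cluster w x) /\ heavy (cluster w y))}.
    apply: (ae_propagate p01 p_gt0 bP genS cG aebad).
      by move=> x; apply/aeW => w [[_ nh] h].
    move=> w e x x' y ve nbad [lx hy]; split; last by apply: heavyS hy; exact: conn_insW.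
    have xx' := conn_ins_edge w ve; rewrite -(cluster_eq xx'); split.
      by apply: rel_infinite_sub lx.1; exact: conn_insW.
    have [_ nhx] := lx.
    move=> /(heavyS (conn_ins_sub ve)) /heavyU[//|/heavyU[//|hx']].
    by apply: nbad; exists x, x'; split=> //; exists e.
  apply: filterS2 ae_unique_heavy => w [[y hy] _] no x lx.
  exact: (no x y).
move=> /existsNP[u0 /existsNP[v0 /existsNP[e0 /not_implyP[ve0 nae]]]]; exfalso.
pose Z w := exists h, H2 h /\
  (light (cluster w (h * u0)%g) /\ heavy (cluster w (h * v0)%g)).
have mZ : event Z.
  apply: event_ex => // h; apply: event_and; first exact: event_cst.
  by apply: event_and; [exact: m_light|exact: event_heavy].
have invZ h w : H2 h -> Z (shift h w) <-> Z w.
  suff imp h' w' : H2 h' -> Z w' -> Z (shift h' w').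
    by move=> Hh; split; [move=> /(imp _ _ (subgroupV gH2 Hh)); rewrite shiftK|exact: imp].
  move=> Hh [k [Hk [lk hk]]]; exists (h' * k)%g; split; first exact: subgroupM.
  rewrite -!mulgA; split; last exact/heavy_shift.
  by apply/(light_shift gH2 heavy_shift).
have infH2 : infinite_set H2.
  by move=> fin; apply: s_normal_infinite; exact: sub_finite_set fin.
have aeZ : {ae P, forall w, Z w}.
  have [P0|P1] := zero_one p01 bP infH2 mZ invZ; last exact: ae_prob1.
  case: nae; have /(ae_prob0 P mZ) := P0; apply: filterS => w nZ uv; apply: nZ.
  by exists 1%g; split; [exact: subgroup1|rewrite !mul1g].
have aeline := ae_line_like gH2 heavyS ve0 bP cG heavy_shift event_heavy.
(* Almost sure properties persist after two openings, whichever they are. *)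
have aeall : {ae P, forall w, forall h k, Z (ins (edge_mul h e0) w) /\
    let w2 := ins (edge_mul k e0) (ins (edge_mul h e0) w) in
    line_like H2 heavy u0 v0 e0 w2 /\
    forall x y, heavy (cluster w2 x) -> heavy (cluster w2 y) -> cluster w2 x y}.
  apply: ae_all => // h; apply: ae_all => // k.
  have ins_ae e Q : {ae P, forall w, Q w} -> {ae P, forall w, Q (ins e w)}.
    exact: (ae_ins p01 bP e p_gt0).
  apply: filterS2 (ins_ae (edge_mul h e0) _ aeZ) (ins_ae (edge_mul h e0) _
    (ins_ae (edge_mul k e0) _ (filterI aeline ae_unique_heavy))) => w Zw [lw [_ uniq]].
  by split=> //; split.
have [w [[h [Hh [lu hv]]] all2]] := ae_sat (filterI aeZ aeall).
have [[k [Hk [lu1 hv1]]] _] := all2 h h.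
have [_ [lw uniq]] := all2 h k.
exact: (two_branches ve0 Hh lu hv Hk lu1 hv1 uniq lw).
Qed.

Lemma ae_unique_supergroup : {ae P, forall w, unique_infinite H2 w}.
Proof.
apply: filterS2 ae_unique_heavy ae_no_light => w [[x hx] uniq] nolight; split.
  by exists x; exact: heavy_rel_infinite.
have heavy_of y : rel_infinite H2 (cluster w y) -> heavy (cluster w y).
  by move=> infy; apply: contrapT => nh; exact: (nolight y).
by move=> y z /heavy_of hy /heavy_of hz; exact: uniq.
Qed.

End Subgroups.
End Uniqueness.

Theorem proposition1p9 (R : realType) (gT : groupType) (S : set gT)
    (finS : finite_set S) (genS : generates S) :
  (forall H1 H2 : set gT,
      subgroup H1 -> subgroup H2 -> H1 `<=` H2 -> s_normal H1 H2 ->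
      (forall p : R, 0 <= p <= 1 ->
         (unique_rel_infinite_as S p H1 <-> unique_rel_infinite_as S p H2)) /\
      p_u_rel S R H1 = p_u_rel S R H2) /\
  (forall H : set gT,
      subgroup H -> s_normal H [set: gT] -> p_u_rel S R H = p_u S R).
Proof.
have cG : countable [set: gT] := countable_generated finS genS.
have uniqE (p : R) A : unique_rel_infinite_as S p A <->
    {ae bernoulli_percolation S p, forall w, unique_infinite A w}.
  by rewrite /unique_rel_infinite_as; split; apply: filterS => w /unique_rel_infiniteP.
have iff (H1 H2 : set gT) : subgroup H1 -> subgroup H2 -> H1 `<=` H2 -> s_normal H1 H2 ->
    forall p : R, 0 <= p <= 1 ->
    (unique_rel_infinite_as S p H1 <-> unique_rel_infinite_as S p H2).
  move=> gH1 gH2 H12 sH12 p p01; rewrite !uniqE.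
  have bP := bernoulli_percolationP finS genS p01; split.
    exact: (ae_unique_supergroup p01 bP genS cG gH1 gH2 H12 sH12).
  apply: (ae_unique_subgroup p01 bP cG gH1 gH2 H12).
  exact: (s_normal_infinite gH1 gH2 sH12).
have p_uE (Q Q' : R -> Prop) : (forall p, 0 <= p <= 1 -> Q p <-> Q' p) ->
    ereal_inf [set p%:E | p in [set p | 0 <= p <= 1 /\ Q p]] =
    ereal_inf [set p%:E | p in [set p | 0 <= p <= 1 /\ Q' p]].
  move=> QQ'; congr (ereal_inf (_ @` _)); apply/seteqP.
  by split=> p /= [p01 /(QQ' _ p01)].
split=> [H1 H2 gH1 gH2 H12 sH12|H gH sH].
  by split; [exact: iff|apply: p_uE; exact: iff].
have gT_ : subgroup [set: gT] by split; rewrite ?in_setT // => x y; rewrite in_setT.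
apply: p_uE => p p01; rewrite (iff H setT gH gT_ _ sH p p01) //.
rewrite /unique_rel_infinite_as /unique_infinite_as.
suff -> : rel_infinite [set: gT] = (fun K => infinite_set K) by [].
by apply/funext => K; rewrite /rel_infinite setIT.
Qed.
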